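(* Let $G=(V,A)$ be a directed graph and let $T^s$ and $T^g$ be two directed trees in $G$ (subgraphs of $G$ that are directed trees) with the same number of arcs. It can be decided in time $O(|V||A|)$ whether there exists a reconfiguration sequence of directed trees between $T^s$ and $T^g$, i.e., a sequence $\langle T_0, T_1, \ldots, T_\ell\rangle$ of directed trees in $G$ with $T_0=T^s$, $T_\ell=T^g$ and $|A(T_i)\setminus A(T_{i+1})| = |A(T_{i+1})\setminus A(T_i)| = 1$ for all $0\le i<\ell$. Moreover, if such a sequence exists, a reconfiguration sequence between $T^s$ and $T^g$ of length $\ell = O(|V|^2)$ can be constructed within the same running time bound.
   Context: A directed tree is a directed graph $T$ whose underlying undirected graph is a tree and in which every vertex except one vertex $r$ has in-degree exactly $1$; the vertex $r$ (of in-degree $0$) is the root, and $T$ is called an $r$-directed tree. A directed tree in $G$ is a subgraph of $G$ that is a directed tree. The length of a sequence $\langle T_0,\ldots,T_\ell\rangle$ is $\ell$. *)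

(* Defs.v *)
From mathcomp Require Import all_boot.
Set Implicit Arguments.
Unset Strict Implicit.
Unset Printing Implicit Defensive.

(** * Directed trees and their reconfiguration *)

Record digraph (V : finType) := Digraph {
  vset : {set V};
  arcs : {set V * V}
}.

Section Digraphs.
Variable V : finType.
Implicit Types (G T : digraph V) (u v r : V).

Definition is_digraph G := arcs G \subset setX (vset G) (vset G).

Definition subgraph T G :=
  [/\ is_digraph T, vset T \subset vset G & arcs T \subset arcs G].

Definition uadj T : rel V :=
  fun u v => ((u, v) \in arcs T) || ((v, u) \in arcs T).

(* The underlying undirected graph is a loopless, nonempty, connected and
   acyclic graph.  A pair of opposite arcs u -> v -> u yields a single edge
   here; such pairs cannot occur in a directed tree, since the in-degree
   condition below forces #|arcs T| = #|vset T| - 1. *)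
Definition underlying_tree T :=
  [/\ irreflexive (uadj T),
      vset T != set0,
      {in vset T &, forall u v, connect (uadj T) u v} &
      forall p : seq V, ucycle (uadj T) p -> size p <= 2].

Definition indegree T v := #|[set u | (u, v) \in arcs T]|.

Definition rooted_tree T r :=
  [/\ is_digraph T, underlying_tree T, r \in vset T, indegree T r = 0 &
      {in vset T, forall v, v != r -> indegree T v = 1}].

Definition directed_tree T := exists r, rooted_tree T r.

Definition directed_tree_in G T := directed_tree T /\ subgraph T G.

(* <T 0, ..., T ell>; the values of T beyond ell are irrelevant. *)
Definition reconf_seq G Ts Tg (ell : nat) (T : nat -> digraph V) :=
  [/\ T 0 = Ts,
      T ell = Tg,
      forall i, i <= ell -> directed_tree_in G (T i) &
      forall i, i < ell ->
        #|arcs (T i) :\: arcs (T i.+1)| = 1 /\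
        #|arcs (T i.+1) :\: arcs (T i)| = 1].

Definition reconfigurable G Ts Tg :=
  exists (ell : nat) (T : nat -> digraph V), reconf_seq G Ts Tg ell T.

End Digraphs.

(** * A word-RAM *)

(* The machine is a word-RAM programmed by structured commands.  Words are the
   naturals below W and arithmetic wraps around modulo W (Sub is truncated at
   0 instead).  A program uses finitely many registers and arrays, all of which
   are zero outside of the input. *)

Inductive expr :=
  | Const of nat
  | Reg of nat
  | Cell of nat & expr            (* Cell a e: cell number e of array a *)
  | Add of expr & expr
  | Sub of expr & expr
  | Mul of expr & expr
  | Lt of expr & expr
  | Eq of expr & expr.

Inductive cmd :=
  | Skip
  | Assign of nat & expr
  | Store of nat & expr & expr    (* Store a e1 e2: a[e1] := e2 *)
  | Seq of cmd & cmd
  | Cond of expr & cmd & cmd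
  | While of expr & cmd.

Record state := State {
  reg : nat -> nat;
  mem : nat -> nat -> nat
}.

Definition set_reg s x k :=
  State (fun y => if y == x then k else reg s y) (mem s).

Definition set_mem s a i k :=
  State (reg s)
    (fun b j => if (b == a) && (j == i) then k else mem s b j).

Fixpoint eval (W : nat) (s : state) (e : expr) : nat :=
  match e with
  | Const k => k %% W
  | Reg x => reg s x
  | Cell a e1 => mem s a (eval W s e1)
  | Add e1 e2 => (eval W s e1 + eval W s e2) %% W
  | Sub e1 e2 => eval W s e1 - eval W s e2
  | Mul e1 e2 => (eval W s e1 * eval W s e2) %% W
  | Lt e1 e2 => eval W s e1 < eval W s e2
  | Eq e1 e2 => eval W s e1 == eval W s e2
  end.

(* exec W c s t s': started in s, the command c halts in s' after t steps.
   Each executed Skip, Assign, Store and each test costs one step; as the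
   expressions of a fixed program have bounded size, this is the running time
   up to a constant factor depending on the program only. *)
Inductive exec (W : nat) : cmd -> state -> nat -> state -> Prop :=
  | exec_skip s : exec W Skip s 1 s
  | exec_assign x e s :
      exec W (Assign x e) s 1 (set_reg s x (eval W s e))
  | exec_store a e1 e2 s :
      exec W (Store a e1 e2) s 1 (set_mem s a (eval W s e1) (eval W s e2))
  | exec_seq c1 c2 s1 s2 s3 t1 t2 :
      exec W c1 s1 t1 s2 -> exec W c2 s2 t2 s3 ->
      exec W (Seq c1 c2) s1 (t1 + t2) s3
  | exec_cond e c1 c2 s t s' :
      exec W (if eval W s e != 0 then c1 else c2) s t s' ->
      exec W (Cond e c1 c2) s t.+1 s'
  | exec_while e c s t s' :
      exec W (if eval W s e != 0 then Seq c (While e c) else Skip) s t s' ->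
      exec W (While e c) s t.+1 s'.

(** * Input and output conventions *)

(* s lists the elements of X, without repetition, in an arbitrary order. *)
Definition listing (T : finType) (s : seq T) (X : {set T}) :=
  perm_eq s (enum X).

Definition of_seq (s : seq nat) : nat -> nat := nth 0 s.

Definition vertex_code n (s : seq 'I_n) : nat -> nat :=
  of_seq [seq val v | v <- s].
Definition tail_code n (s : seq ('I_n * 'I_n)) : nat -> nat :=
  of_seq [seq val a.1 | a <- s].
Definition head_code n (s : seq ('I_n * 'I_n)) : nat -> nat :=
  of_seq [seq val a.2 | a <- s].

(* The vertices of the graph are 0, ..., n - 1 and its arcs are given as a list
   of pairs; each of the two trees is given by the list of its vertices and the
   list of its arcs. *)
Definition input_state n (A : seq ('I_n * 'I_n))
    (Vs : seq 'I_n) (As : seq ('I_n * 'I_n))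
    (Vg : seq 'I_n) (Ag : seq ('I_n * 'I_n)) : state :=
  State
    (of_seq [:: n; size A; size Vs; size As; size Vg; size Ag])
    (nth (fun=> 0)
       [:: tail_code A; head_code A;
           vertex_code Vs; tail_code As; head_code As;
           vertex_code Vg; tail_code Ag; head_code Ag]).

Definition accepts (s : state) := reg s 0 != 0.

(* A sequence <T 0, ..., T ell> is output as the list of its exchanges (listing
   all trees in full could take more than |V||A| steps): register 1 holds ell,
   and for i < ell the arc leaving T i is (mem 0 i, mem 1 i) and the arc
   entering T i.+1 is (mem 2 i, mem 3 i). *)
Definition outputs n (s : state) (ell : nat) (T : nat -> digraph 'I_n) :=
  reg s 1 = ell /\
  forall i, i < ell -> forall u v : 'I_n,
    ((u, v) \in arcs (T i) :\: arcs (T i.+1))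
      = (mem s 0 i == u) && (mem s 1 i == v) /\
    ((u, v) \in arcs (T i.+1) :\: arcs (T i))
      = (mem s 2 i == u) && (mem s 3 i == v).

(* Main.v *)
Require Import Defs.
From mathcomp Require Import all_boot zify.
Set Implicit Arguments.
Unset Strict Implicit.
Unset Printing Implicit Defensive.

(* Let k be the number of arcs.  There is nothing to do for k = 0, and a single
   arc can be exchanged for any other one, so let k >= 2.

   Two trees with the same root r are always connected: take the arcs (u, w) of
   the goal tree from the root downwards, and exchange for (u, w) the arc into w
   of the current tree or, if w is not in it, the last arc (in a fixed top-down
   order) that does not lead to a vertex reached by the arcs already taken.
   This takes at most k exchanges, so only the roots matter.

   Join x and v by an edge for every arc (x, v) of G such that some tree with k
   arcs has root x and some tree with k - 1 arcs has root v.  If one exchange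
   changes the root r into r', then either one of the roots lies in the other
   tree, below the other root, and the path between them consists of edges, or
   r and r' both have a single child, which is the same vertex v, and r, v, r'
   is a path.  Conversely, let (x, v) be an edge.  If v is the root of a tree D
   with k arcs, one exchange adds (x, v) to D and removes the arc into x, or the
   last arc if x is not in D.  Otherwise the trees with k - 1 arcs and root v
   contain everything v reaches, hence none of the vertices joined to v, and
   (x, v) can be exchanged for (y, v) above such a tree.

   The algorithm searches from every vertex until k arcs have been found, which
   gives the edges; it labels the component of the root of Tg, and follows the
   labels from the root of Ts, with at most k + 1 exchanges and O(|A|) steps for
   each of the at most |V| labels on the way. *)

(** * Trees as growing lists of arcs *)

(** Being the root of a tree with [k] arcs is inherited upwards: an arc from [u] to such a root lets
    [u] carry [k] arcs too. This is why a path inside a tree between two possible roots consists of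
    edges. An edge asks only for [k - 1] arcs at [v] because exchanging [(x, v)] for [(y, v)] keeps
    exactly that much below the root. The negative answer rests on an invariant: the set of labelled
    vertices is closed under edges in both directions, so no sequence can move the root into or out
    of it. Spending only O(|A|) per label depends on two economies. A search erases just the marks
    that it has set, so it never pays for all vertices. And while one tree is changed into another
    with the same root, the pointer to the last removable arc only moves towards the front, because
    a vertex once reached by the arcs already taken remains so; all its moves together cost O(k),
    with k <= |A|. Since also k < |V|, the k + 1 exchanges per label give O(|V|^2) in total. *)

Section Growing.
Variable T : eqType.
Implicit Types (vs C : seq T) (l q A D : seq (T * T)) (a b : T * T).
Implicit Types (r u v w x z h : T).

Definition heads l : seq T := [seq a.2 | a <- l].

(* A tree with root r is represented by a list l of its arcs, ordered so that
   grows [:: r] l. *)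
Fixpoint grows vs l :=
  if l is a :: l' then
    [&& a.1 \in vs, a.2 \notin vs & grows (a.2 :: vs) l']
  else true.

Lemma grows_eqm vs vs' l : vs =i vs' -> grows vs l = grows vs' l.
Proof.
elim: l vs vs' => [|a l IH] vs vs' E //=.
by rewrite !E (IH (a.2 :: vs) (a.2 :: vs')) // => z; rewrite !inE E.
Qed.

Lemma grows_cat vs l1 l2 :
  grows vs (l1 ++ l2) = grows vs l1 && grows (heads l1 ++ vs) l2.
Proof.
elim: l1 vs => [|a l1 IH] vs //=.
rewrite IH !andbA; congr (_ && _); apply: grows_eqm => z.
by rewrite !(mem_cat, inE); do !bool_congr.
Qed.

Lemma grows_rcons vs l a :
  grows vs (rcons l a) =
  [&& grows vs l, a.1 \in heads l ++ vs & a.2 \notin heads l ++ vs].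
Proof. by rewrite -cats1 grows_cat /= !andbT. Qed.

Lemma grows_take vs l i : grows vs l -> grows vs (take i l).
Proof. by rewrite -{1}(cat_take_drop i l) grows_cat => /andP[]. Qed.

Lemma grows_notin vs l v : grows vs l -> v \in heads l -> v \notin vs.
Proof.
elim: l vs => [|a l IH] vs //= /and3P[_ av g]; rewrite inE.
by case/orP => [/eqP->//|/(IH _ g)]; rewrite inE negb_or => /andP[].
Qed.

Lemma grows_uniq vs l : grows vs l -> uniq (heads l).
Proof.
elim: l vs => [|a l IH] vs //= /and3P[_ _ g]; rewrite (IH _ g) andbT.
by apply/negP => /(grows_notin g); rewrite mem_head.
Qed.

Lemma grows_uniq_root r l : grows [:: r] l -> uniq (r :: heads l).
Proof.
move=> g /=; rewrite (grows_uniq g) andbT.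
by apply/negP => /(grows_notin g); rewrite mem_head.
Qed.

Lemma grows_uniq_arcs vs l : grows vs l -> uniq l.
Proof. by move=> g; exact: map_uniq (grows_uniq g). Qed.

Lemma grows_tail vs l a : grows vs l -> a \in l -> a.1 \in vs ++ heads l.
Proof.
elim: l vs => [|b l IH] vs //= /and3P[bv _ g]; rewrite inE.
case/orP => [/eqP->|/(IH _ g)]; rewrite !(mem_cat, inE) ?bv //.
by case: (_ == _) => //=; rewrite ?orbT.
Qed.

(** A dropped arc leads into [vs'], so its head is available from the start and no later arc loses
    its tail. Exchanges inside a tree and above its root are both instances. *)
Lemma grows_filter vs vs' l : grows vs l -> {subset vs <= vs'} ->
  grows vs' [seq a <- l | a.2 \notin vs'].
Proof.
elim: l vs vs' => [|a l IH] vs vs' //= /and3P[av nav g] sub.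
case: ifP => [na|/negbFE ia] /=.
- rewrite (sub _ av) na /=.
  have {IH} := IH _ (a.2 :: vs') g.
  (* No later arc has head [a.2], so excluding that head as well changes nothing. *)
  rewrite (@eq_in_filter _ _ (fun b => b.2 \notin vs') l).
    apply=> z; rewrite !inE; case/orP=> [->//|/sub->]; exact: orbT.
  move=> b bl; rewrite inE negb_or.
  suff -> : b.2 != a.2 by [].
  have /(grows_notin g) : b.2 \in heads l by apply: map_f.
  by rewrite inE negb_or => /andP[].
- apply: IH g _ => z; rewrite inE => /orP[/eqP-> //|/sub //].
Qed.

(* evict z q is the arc that has to leave q so that z becomes available as a
   new head: the arc into z if there is one, and otherwise the last arc. *)
Definition evict z q := head (last (z, z) q) [seq a <- q | a.2 == z].
(** If [z] is a head, the filter already removes one arc and [take] is idle; otherwise the filter is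
    idle and [take] drops the last arc. *)
Definition rest z q := take (size q).-1 [seq a <- q | a.2 != z].

Lemma filter_headE q a : uniq (heads q) -> a \in q ->
  [seq b <- q | b.2 == a.2] = [:: a].
Proof.
elim: q => [|b q IH] //= /andP[nb uq]; rewrite inE => /orP[/eqP->|aq].
  rewrite eqxx; congr (_ :: _); apply/eqP; rewrite -[_ == _]negbK -has_filter.
  by apply/negP => /hasP[c cq /eqP E]; case/negP: nb; rewrite -E map_f.
case: eqP => [E|_]; last exact: IH.
by case/negP: nb; rewrite E map_f.
Qed.

Lemma filter_headN q z : z \notin heads q -> [seq b <- q | b.2 == z] = [::].
Proof.
move=> nz; apply/eqP; rewrite -[_ == _]negbK -has_filter.
by apply/negP => /hasP[c cq /eqP E]; case/negP: nz; rewrite -E map_f.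
Qed.

Lemma filter_headNC q z : z \notin heads q -> [seq b <- q | b.2 != z] = q.
Proof.
move=> nz; apply/all_filterP/allP => b bq.
by apply: contra nz => /eqP <-; exact: map_f.
Qed.

Lemma evict_head q a : uniq (heads q) -> a \in q -> evict a.2 q = a.
Proof. by move=> uq aq; rewrite /evict filter_headE. Qed.

Lemma rest_head q a : uniq (heads q) -> a \in q ->
  rest a.2 q = [seq b <- q | b.2 != a.2].
Proof.
move=> uq aq; rewrite /rest take_oversize //.
have := count_predC (fun b => b.2 == a.2) q.
by rewrite -!size_filter (filter_headE uq aq) /= => <-.
Qed.

Lemma evict_last q a z : z \notin heads (rcons q a) -> evict z (rcons q a) = a.
Proof. by move=> nz; rewrite /evict filter_headN // last_rcons. Qed.

Lemma rest_last q a z : z \notin heads (rcons q a) -> rest z (rcons q a) = q.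
Proof.
by move=> nz; rewrite /rest filter_headNC // size_rcons -cats1 take_size_cat.
Qed.

Lemma evict_rest z q : q != [::] -> uniq (heads q) ->
  perm_eq q (evict z q :: rest z q).
Proof.
move=> q0 uq; case: (boolP (z \in heads q)) => [/mapP[a aq ->]|nz].
  rewrite evict_head // rest_head // perm_sym -cat1s -(filter_headE uq aq).
  by rewrite perm_filterC.
case: q q0 uq nz => // b q _ _; rewrite lastI => nz.
by rewrite evict_last // rest_last // perm_rcons.
Qed.

(** Arcs of [q] below [b.2] stay usable because [b.2] is now available earlier, and the last arc of
    a growing list ends in a leaf, so it can be cut. *)
Lemma grows_exchange r p q b : grows [:: r] (p ++ q) ->
  b.1 \in r :: heads p -> b.2 \notin r :: heads p ->
  grows [:: r] (p ++ b :: rest b.2 q).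
Proof.
rewrite !grows_cat => /andP[-> gq] b1 b2 /=.
have E v : (v \in heads p ++ [:: r]) = (v \in r :: heads p).
  by rewrite mem_cat !inE orbC.
rewrite !E b1 b2 /=; apply: grows_take.
have sub : {subset heads p ++ [:: r] <= b.2 :: heads p ++ [:: r]}.
  by move=> v vi; rewrite inE vi orbT.
rewrite -(@eq_in_filter _ (fun a => a.2 \notin b.2 :: heads p ++ [:: r])).
  exact: grows_filter gq sub.
move=> a aq; rewrite inE negb_or (grows_notin gq (map_f _ aq)) andbT //.
Qed.

(** The arc into [x], if any, has to go because [x] becomes the root; what hung below [x] now hangs
    from the root. *)
Lemma grows_link h x l j : grows [:: h] l -> x != h ->
  grows [:: x] ((x, h) :: take j [seq a <- l | a.2 != x]).
Proof.
move=> g xh /=; rewrite !inE eqxx eq_sym xh /=; apply: grows_take.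
rewrite -(@eq_in_filter _ (fun a => a.2 \notin [:: h; x])).
  by apply: grows_filter g _ => z; rewrite !inE => ->.
move=> a al; rewrite !inE negb_or.
have := grows_notin g (map_f _ al); rewrite inE => -> //.
Qed.

Definition arc_closed A C := forall a, a \in A -> a.1 \in C -> a.2 \in C.

Lemma grows_closed A C vs l : grows vs l -> {subset vs <= C} ->
  arc_closed A C -> {subset l <= A} -> {subset heads l <= C}.
Proof.
move=> g sub cl; elim: l vs g sub => [|a l IH] vs //= /and3P[av _ g] sub lA.
have aC : a.2 \in C by apply: cl (sub _ av); apply: lA; rewrite mem_head.
move=> z; rewrite inE => /orP[/eqP->//|]; apply: IH g _ _ z.
  by move=> y; rewrite inE => /orP[/eqP->|/sub].
by move=> b bl; apply: lA; rewrite inE bl orbT.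
Qed.

(** * Roots of trees with a given number of arcs *)

Definition rtree A k r l := [/\ grows [:: r] l, size l = k & {subset l <= A}].
Definition feasible A k r := exists l, rtree A k r l.

Lemma feasibleW A k j r : j <= k -> feasible A k r -> feasible A j r.
Proof.
move=> jk [l [g sz sub]]; exists (take j l); split.
- exact: grows_take.
- by rewrite size_takel ?sz.
- by move=> a /mem_take/sub.
Qed.

(** Everything reachable from [x] lies among the [size D + 1] vertices of [D]. A search that gets
    stuck thus settles the question for all the vertices that it met, not only for its start. *)
Lemma feasible_closed A j h x D : arc_closed A (h :: heads D) ->
  x \in h :: heads D -> feasible A j x -> j <= size D.
Proof.
move=> cl xD [l [gl <- lA]].
have s : {subset x :: heads l <= h :: heads D}.
  move=> z; rewrite inE => /orP[/eqP->//|].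
  by apply: grows_closed gl _ cl lA z => y; rewrite inE => /eqP->.
have := uniq_leq_size (grows_uniq_root gl) s.
by rewrite /= !size_map ltnS.
Qed.

Lemma rtree_link A k h x D : 0 < k -> rtree A k h D -> x != h -> (x, h) \in A ->
  rtree A k x ((x, h) :: rest x D).
Proof.
move=> k0 [g sz sub] xh xhA; split.
- exact: grows_link.
- have D0 : D != [::] by rewrite -size_eq0 sz -lt0n.
  by have /perm_size := evict_rest x D0 (grows_uniq g); rewrite sz.
- move=> a; rewrite inE => /orP[/eqP->//|/mem_take].
  by rewrite mem_filter => /andP[_ /sub].
Qed.

Lemma feasible_up A k h x : 0 < k -> feasible A k h -> x != h -> (x, h) \in A ->
  feasible A k x.
Proof. by move=> k0 [D d] xh xA; exists ((x, h) :: rest x D); exact: rtree_link. Qed.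

(* For k > 1, roots of trees with k arcs can be changed into each other exactly
   within the components of this relation, taken as an undirected graph.  The
   vertex v need not itself be the root of a tree with k arcs. *)
Definition linked A k x v :=
  [/\ (x, v) \in A, feasible A k x & feasible A k.-1 v].

(** * The root before and after one exchange *)

Section Invariant.
Variables (A : seq (T * T)) (k : nat) (P : T -> Prop).
Hypothesis Plinked : forall x v, linked A k x v -> (P x <-> P v).

(** By [feasible_up] all ancestors of [w] in [l] are feasible, so every arc on the path from [r] to
    [w] is a link. Removing last arcs climbs this path. *)
Lemma feasible_invariant r l w : 0 < k ->
  grows [:: r] l -> {subset l <= A} -> w \in r :: heads l ->
  feasible A k w -> (P r <-> P w).
Proof.
move=> k0; elim/last_ind: l w => [|l a IH] w; first by rewrite mem_seq1 => _ _ /eqP->.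
rewrite grows_rcons => /and3P[g a1 a2] sub.
have sub' : {subset l <= A} by move=> b bl; apply: sub; rewrite mem_rcons inE bl orbT.
rewrite /heads map_rcons -rcons_cons mem_rcons inE => /orP[/eqP->|wl]; last exact: IH.
move=> f; have aA : (a.1, a.2) \in A by rewrite -surjective_pairing sub // mem_rcons mem_head.
have fa : feasible A k a.1.
  by apply: feasible_up f _ aA => //; apply: contra a2 => /eqP <-.
have Pa : P a.1 <-> P a.2.
  by apply: Plinked; split=> //; apply: feasibleW f; exact: leq_pred.
by rewrite -Pa; apply: IH => //; move: a1; rewrite mem_cat !inE orbC.
Qed.

Lemma grows_rootE vs v l : grows vs l -> size l > 0 ->
  {in l, forall a, a.1 \in vs -> a.1 = v} -> exists w, (v, w) \in l.
Proof.
case: l => // a l /= /and3P[a1 _ _] _ H; exists a.2.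
by rewrite -(H a) ?mem_head // -surjective_pairing mem_head.
Qed.

(** If neither root is a vertex of the other tree, no common arc leaves a root. So each root has
    only its exchanged arc, and [c] is a tree with [k - 1] arcs below both of them. As [k > 1], [c]
    is nonempty and determines its root. *)
Lemma root_exchange r r' l l' e f c : 1 < k ->
  rtree A k r l -> rtree A k r' l' -> perm_eq l (e :: c) -> perm_eq l' (f :: c) ->
  P r <-> P r'.
Proof.
move=> k1 tl tl' pl pl'.
have k0 : 0 < k by apply: ltnW.
have [g sz sub] := tl; have [g' sz' sub'] := tl'.
have [rl'|nr] := boolP (r \in r' :: heads l').
  by symmetry; apply: (feasible_invariant k0 g' sub' rl'); exists l.
have [rl|nr'] := boolP (r' \in r :: heads l).
  by apply: (feasible_invariant k0 g sub rl); exists l'.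
(* Stated for both orders of the two trees: [v] is the only child of [s], and the arc of [c] that
   leaves [v] serves to identify the children found from the two sides. *)
have main s s' m m' e' f' : rtree A k s m -> rtree A k s' m' ->
    perm_eq m (e' :: c) -> perm_eq m' (f' :: c) -> s \notin s' :: heads m' ->
    exists v, [/\ (s, v) \in A, feasible A k.-1 v, v \notin heads c,
                  (forall a, a \in c -> a.1 \in v :: heads c) &
                  exists w, (v, w) \in c].
  move=> [+ szm subm] [gm' szm' _] pm pm' ns; case: m pm szm subm => [|a m] pm szm subm.
    by move: k0; rewrite -szm.
  move=> gm; have sc : {subset c <= m'}.
    by move=> b bc; rewrite (perm_mem pm') inE bc orbT.
  have nt b : b \in c -> b.1 != s.
    by move=> bc; apply: contra ns => /eqP<-; have := grows_tail gm' (sc _ bc); rewrite /=.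
  case/and3P: (gm); rewrite inE => /eqP a1 a2 gm2.
  have ae : a = e'.
    have : a \in e' :: c by rewrite -(perm_mem pm) mem_head.
    by rewrite inE => /orP[/eqP//|/nt]; rewrite a1 eqxx.
  have pc : perm_eq m c by move: pm; rewrite ae perm_cons.
  exists a.2; split.
  - by rewrite -a1 -surjective_pairing subm ?mem_head.
  - exists m; split; last by move=> b bm; apply: subm; rewrite inE bm orbT.
      (* Since no remaining arc leaves [s], it can be struck from the available vertices. *)
      have : {in m, forall b, b.1 != s} by move=> b; rewrite (perm_mem pc) => /nt.
      move: gm2; rewrite (_ : [:: a.2; s] = [:: a.2] ++ [:: s]) //.
      elim: m [:: a.2] {gm szm subm pm pc} => [|b m IH] vs //= /and3P[b1 b2 gb] H.
      move: b1 b2; rewrite !mem_cat !inE (negbTE (H b (mem_head _ _))) orbF => ->.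
      rewrite negb_or => /andP[-> _] /=; apply: (IH (b.2 :: vs) gb) => d dm; apply: H.
      by rewrite inE dm orbT.
    by rewrite -szm.
  - rewrite -(perm_mem (perm_map _ pc)).
    by apply/negP => /(grows_notin gm2); rewrite mem_head.
  - move=> b; rewrite -(perm_mem pc) => bm; have := grows_tail gm2 bm.
    rewrite /= !inE (negbTE (nt b _)) -?(perm_mem pc) //= => /orP[->//|H].
    by rewrite -(perm_mem (perm_map _ pc)) H orbT.
  - have m0 : 0 < size m by move: k1; rewrite -szm.
    have [w wm] : exists w, (a.2, w) \in m.
      apply: (grows_rootE gm2 m0) => b bm; rewrite !inE => /orP[/eqP//|].
      by rewrite (negbTE (nt b _)) // -(perm_mem pc).
    by exists w; rewrite -(perm_mem pc).
have [v [rv fv nv tv [w vw]]] := main r r' l l' e f tl tl' pl pl' nr.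
have [v' [rv' fv' nv' tv' _]] := main r' r l' l f e tl' tl pl' pl nr'.
(* [v] is a tail in [c] but not a head, whereas every tail in [c] is [v'] or a head. *)
have vv : v = v'.
  by have := tv' _ vw; rewrite /= inE (negbTE nv) orbF => /eqP.
have -> : P r <-> P v by apply: Plinked; split=> //; exists l.
by symmetry; rewrite vv; apply: Plinked; split=> //; exists l'.
Qed.

End Invariant.

(** * Traces of exchanges *)

Definition exchange (x : (T * T) * (T * T)) l l' := exists c,
  [/\ perm_eq l (x.1 :: c), perm_eq l' (x.2 :: c) & x.1 != x.2].

(** Lists stand for arc sets, so the end counts up to permutation; intermediate roots are
    existential because an exchange may move the root. *)
Fixpoint recon A k l (tr : seq ((T * T) * (T * T))) l' : Prop :=
  if tr is x :: tr' then
    exists l1, [/\ (exists r, rtree A k r l1), exchange x l l1 & recon A k l1 tr' l']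
  else perm_eq l l'.

Lemma recon_perm A k l tr l1 l2 : recon A k l tr l1 -> perm_eq l1 l2 ->
  recon A k l tr l2.
Proof.
elim: tr l => [|x tr IH] l /=; first exact: perm_trans.
by move=> [l' [t e rc]] p; exists l'; split=> //; apply: IH.
Qed.

Lemma recon_rcons A k l tr l1 (x : (T * T) * (T * T)) l2 r :
  recon A k l tr l1 -> exchange x l1 l2 ->
  rtree A k r l2 -> recon A k l (rcons tr x) l2.
Proof.
elim: tr l => [|y tr IH] l /=.
  move=> p [c [p1 p2 n]] t; exists l2; split=> //; first by exists r.
  by exists c; split=> //; apply: perm_trans p p1.
by move=> [l' [t e rc]] p t2; exists l'; split=> //; apply: IH.
Qed.

End Growing.

(** * Growing lists and directed trees *)

Section GrowingDigraph.
Variable V : finType.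
Implicit Types (T : digraph V) (u v w r : V) (l : seq (V * V)).

Lemma indegree_unique T u v w : indegree T v = 1 ->
  (u, v) \in arcs T -> (w, v) \in arcs T -> u = w.
Proof.
by move=> /eqP/cards1P[x E] uv wv; have := in_set1 u x; have := in_set1 w x;
  rewrite -E !inE uv wv => /esym/eqP-> /esym/eqP->.
Qed.

Lemma arcs_vset T u v : is_digraph T -> (u, v) \in arcs T ->
  (u \in vset T) && (v \in vset T).
Proof. by move=> /subsetP dT /dT; rewrite !inE. Qed.

Lemma rooted_tree_root_tail T r u : rooted_tree T r -> (u, r) \notin arcs T.
Proof.
case=> _ _ _ d0 _; apply/negP => ur.
by move/eqP: d0; rewrite cards_eq0 => /eqP/setP/(_ u); rewrite !inE ur.
Qed.

Lemma rooted_tree_root_unique T r r' :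
  rooted_tree T r -> rooted_tree T r' -> r = r'.
Proof.
move=> [_ _ rT d0 _] [_ _ _ _ d1]; apply/eqP; apply: contraT => /d1.
by rewrite d0 => /(_ rT).
Qed.

(** By in-degree one, an arc into a covered vertex is the arc of [l] into it, so its tail is covered
    too. The covered vertices are then closed under undirected adjacency, and connectedness makes
    them all vertices. *)
Lemma closed_growing_tree T r l : rooted_tree T r -> grows [:: r] l ->
  {subset l <= arcs T} ->
  (forall a, a \in arcs T -> a.1 \in r :: heads l -> a.2 \in r :: heads l) ->
  vset T =i r :: heads l /\ perm_eq l (enum (arcs T)).
Proof.
move=> rT g sub cl; have [dT [_ _ conn _] rV d0 d1] := rT.
have inl u v : (u, v) \in arcs T -> v \in r :: heads l -> (u, v) \in l.
  move=> uv; rewrite inE => /orP[/eqP E|/mapP[a al E]].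
    by move: uv; rewrite E (negbTE (rooted_tree_root_tail _ rT)).
  have /andP[_ vT] := arcs_vset dT uv.
  have vr : v != r.
    by apply/negP => /eqP E'; move: uv; rewrite E' (negbTE (rooted_tree_root_tail _ rT)).
  have av : (a.1, v) \in arcs T by rewrite E -surjective_pairing sub.
  by rewrite (indegree_unique (d1 _ vT vr) uv av) E -surjective_pairing.
have step u w : u \in r :: heads l -> uadj T u w -> w \in r :: heads l.
  move=> uC /orP[uw|wu]; first exact: cl uw uC.
  by have := grows_tail g (inl _ _ wu uC).
have cov : {subset vset T <= r :: heads l}.
  move=> v vT; have /connectP[p + ->] := conn _ _ rV vT.
  elim: p {1 3 4}r (mem_head r (heads l)) => [|w p IH] u uC //= /andP[uw].
  by apply: IH; exact: step uC uw.
have sub' : {subset r :: heads l <= vset T}.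
  move=> v; rewrite inE => /orP[/eqP->//|/mapP[a /sub aT ->]].
  by move: aT; rewrite [a]surjective_pairing => /(arcs_vset dT)/andP[].
split; first by move=> v; apply/idP/idP => [/cov|/sub'].
apply: uniq_perm (grows_uniq_arcs g) (enum_uniq _) _ => a.
rewrite mem_enum; apply/idP/idP => [/sub//|].
rewrite [a]surjective_pairing => aT; apply: inl => //.
by case/andP: (arcs_vset dT aT) => _ /cov.
Qed.

Lemma rooted_tree_growing T r : rooted_tree T r -> exists l,
  [/\ grows [:: r] l, vset T =i r :: heads l & perm_eq l (enum (arcs T))].
Proof.
move=> rT; pose good l := grows [:: r] l /\ {subset l <= arcs T}.
have [l [[g sub] cl]] : exists l, good l /\
    forall a, a \in arcs T -> a.1 \in r :: heads l -> a.2 \in r :: heads l.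
  (* The list either reaches any length [j] or stops at a closed one; length [#|V|] would need one
     vertex too many. *)
  have ext j : (exists l, good l /\ size l = j) \/ exists l, good l /\
      forall a, a \in arcs T -> a.1 \in r :: heads l -> a.2 \in r :: heads l.
    elim: j => [|j [[l [[g sub] sz]]|]]; [by left; exists [::]| |by right].
    have [/existsP[a /and3P[aT a1 a2]]|no] := boolP [exists a, [&& a \in arcs T,
        a.1 \in r :: heads l & a.2 \notin r :: heads l]].
      left; exists (rcons l a); split; last by rewrite size_rcons sz.
      split; last by move=> b; rewrite mem_rcons inE => /orP[/eqP->|/sub].
      by rewrite grows_rcons g !mem_cat ![_ || (_ \in [:: r])]orbC -!mem_cat /= a1.
    right; exists l; split=> // a aT a1; move: no.
    by rewrite negb_exists => /forallP/(_ a); rewrite aT a1 /= negbK.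
  case: (ext #|V|) => // -[l [[g _] sz]].
  have := max_card (mem (r :: heads l)).
  by rewrite (card_uniqP (grows_uniq_root g)) /= size_map sz ltnn.
have [? ?] := closed_growing_tree rT g sub cl.
by exists l.
Qed.

Lemma grows_loopless (vs : seq V) l u : grows vs l -> (u, u) \notin l.
Proof.
elim: l vs => [|a l IH] vs //= /and3P[a1 a2 /IH ul]; rewrite inE negb_or ul andbT.
by apply/eqP => E; move: a1 a2; rewrite -E /= => ->.
Qed.

Definition digraph_of r l : digraph V := Digraph [set v in r :: heads l] [set a in l].

Lemma uadj_digraph_of r l u v :
  uadj (digraph_of r l) u v = ((u, v) \in l) || ((v, u) \in l).
Proof. by rewrite /uadj !inE. Qed.

(** The head of the last arc is a leaf, which cannot have two neighbours on a cycle; a cycle that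
    avoids it already lives in the shorter list. *)
Lemma digraph_of_acyclic r l p : grows [:: r] l ->
  ucycle (uadj (digraph_of r l)) p -> size p <= 2.
Proof.
elim/last_ind: l p => [|l a IH] p g /andP[cp up].
  case: p cp up => [|x p] //=.
  by case: p => [|y p] /=; rewrite uadj_digraph_of.
have := g; rewrite grows_rcons => /and3P[gl a1 a2].
have outside u v : v != a.2 -> u != a.2 ->
    uadj (digraph_of r (rcons l a)) u v -> uadj (digraph_of r l) u v.
  move=> va ua; rewrite !uadj_digraph_of !mem_rcons !inE.
  have -> : (u, v) == a = false by apply/eqP => E; rewrite -E eqxx in va.
  by have -> : (v, u) == a = false by apply/eqP => E; rewrite -E eqxx in ua.
have nbr v : uadj (digraph_of r (rcons l a)) a.2 v -> v = a.1.
  have na u w : (u, w) \in l -> (u != a.2) && (w != a.2).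
    move=> uw; have := grows_tail gl uw; have := map_f snd uw => /= wl ul.
    apply/andP; split; apply: contra a2 => /eqP<-.
      by rewrite mem_cat inE orbC; move: ul; rewrite inE.
    by rewrite mem_cat /heads wl.
  rewrite uadj_digraph_of !mem_rcons !inE => /orP[]/orP[/eqP E|/na].
  - have E1 : a.1 = a.2 := esym (congr1 fst E).
    by have := grows_loopless a.2 g; rewrite mem_rcons inE -{1}E1 -surjective_pairing eqxx.
  - by rewrite eqxx.
  - by rewrite -E.
  - by rewrite eqxx andbF.
have [/rot_to[i q E]|ap] := boolP (a.2 \in p); last first.
  apply: (IH p gl); rewrite /ucycle up andbT.
  apply: sub_in_cycle (_ : all (fun v => v != a.2) p) cp.
    by move=> u v ua va; exact: outside.
  by apply/allP => v vp; apply: contra ap => /eqP<-.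
(* Rotated to start at the leaf, a longer cycle has [a.1] both in second and in last place. *)
have := cp; have := up; rewrite -(rot_uniq i) -(rot_cycle i) -(size_rot i) E.
case: q {E} => [|x [|y q]] //= /and3P[_ xq _] /andP[/nbr x1].
rewrite rcons_path => /and3P[_ _]; rewrite /uadj orbC => /nbr y1.
by move: xq; rewrite x1 -y1 mem_last.
Qed.

Lemma growing_rooted_tree r l : grows [:: r] l -> rooted_tree (digraph_of r l) r.
Proof.
move=> g; have ug := grows_uniq_root g; split.
- apply/subsetP => a; rewrite !inE => al; rewrite map_f // orbT andbT.
  by have := grows_tail g al; rewrite mem_cat inE.
- split.
  + by move=> u; rewrite uadj_digraph_of orbb (negbTE (grows_loopless _ g)).
  + by apply/set0Pn; exists r; rewrite !inE eqxx.
  + have csym : connect_sym (uadj (digraph_of r l)).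
      by apply: sym_connect_sym => u v; rewrite /uadj orbC.
    have H w : w \in vset (digraph_of r l) -> connect (uadj (digraph_of r l)) r w.
      rewrite inE => wV; suff : w \in enum (connect (uadj (digraph_of r l)) r).
        by rewrite mem_enum.
      move: wV; rewrite inE => /orP[/eqP->|wl]; first by rewrite mem_enum [_ \in _]connect0.
      apply: (grows_closed g _ _ _ wl) => [z|a al|z zl]; last exact: zl.
        by rewrite inE => /eqP->; rewrite mem_enum [_ \in _]connect0.
      rewrite !mem_enum => ra; apply: connect_trans ra (connect1 _).
      by rewrite uadj_digraph_of -surjective_pairing al.
    by move=> u v /H ru /H rv; apply: connect_trans rv; rewrite csym.
  + by move=> p; exact: digraph_of_acyclic.
- by rewrite !inE eqxx.
- apply/eqP; rewrite cards_eq0; apply/eqP/setP => u; rewrite !inE.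
  by apply/negbTE; case/andP: ug => + _; apply: contra => ul; apply/mapP; exists (u, r).
- move=> v; rewrite !inE => /orP[/eqP->|/mapP[a al ->] _]; first by rewrite eqxx.
  apply/eqP/cards1P; exists a.1; apply/setP => u; rewrite !inE.
  apply/idP/eqP => [ul|->]; last by rewrite -surjective_pairing.
  have := filter_headE (grows_uniq g) al.
  have : (u, a.2) \in [seq b <- l | b.2 == a.2] by rewrite mem_filter eqxx.
  by move=> /[swap] ->; rewrite inE => /eqP<-.
Qed.

Lemma directed_tree_vset T v : directed_tree T -> 0 < #|arcs T| ->
  (v \in vset T) = [exists a in arcs T, (v == a.1) || (v == a.2)].
Proof.
move=> [r rT] T0; have [dT _ _ _ _] := rT.
have [l [g E p]] := rooted_tree_growing rT.
have sub a : a \in l -> a \in arcs T by rewrite (perm_mem p) mem_enum.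
apply/idP/existsP => [|[a /andP[]]]; last first.
  rewrite [a]surjective_pairing => /(arcs_vset dT)/andP[? ?].
  by case/orP => /eqP->.
rewrite E inE => /orP[/eqP->|/mapP[a /sub aT ->]]; last by exists a; rewrite aT eqxx orbT.
case: l {E p} sub g (perm_size p) => [|a l] sub; first by rewrite -cardE => _ E; rewrite -E in T0.
by move=> /= /andP[+ _] _; rewrite inE => /eqP<-; exists a; rewrite sub ?mem_head ?eqxx.
Qed.

(** Exchanges know only arc sets; this returns to equality of digraphs. Without arcs the single
    vertex is undetermined, which is why [k = 0] is a case of its own. *)
Lemma directed_tree_eq T T' : directed_tree T -> directed_tree T' ->
  0 < #|arcs T| -> arcs T = arcs T' -> T = T'.
Proof.
move=> dT dT' T0 E; have E' : vset T = vset T'.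
  by apply/setP => v; rewrite !directed_tree_vset -?E.
by case: T T' E E' {dT dT' T0} => [? ?] [? ?] /= -> ->.
Qed.

End GrowingDigraph.

(** * Arcs as pairs of numbers *)

Section Codes.
Variable n : nat.
Implicit Types (G T : digraph 'I_n) (A l : seq ('I_n * 'I_n)).

Definition code_arc (a : 'I_n * 'I_n) : nat * nat := (val a.1, val a.2).

Lemma code_arc_inj : injective code_arc.
Proof. by move=> [a b] [c d] [/val_inj-> /val_inj->]. Qed.

Lemma grows_code (vs : seq 'I_n) l :
  grows [seq val v | v <- vs] [seq code_arc a | a <- l] = grows vs l.
Proof.
elim: l vs => [|a l IH] vs //=.
by rewrite !(mem_map val_inj) -(IH (_ :: _)).
Qed.

Lemma heads_code l : heads [seq code_arc a | a <- l] = [seq val v | v <- heads l].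
Proof. by rewrite /heads -!map_comp. Qed.

Lemma code_arc_sub A (l : seq (nat * nat)) : {subset l <= [seq code_arc a | a <- A]} ->
  exists2 l0, l = [seq code_arc a | a <- l0] & {subset l0 <= A}.
Proof.
elim: l => [|a l IH] sub; first by exists [::].
have /mapP[b bA ->] := sub _ (mem_head _ _).
have [|l0 -> l0A] := IH; first by move=> c cl; apply: sub; rewrite inE cl orbT.
by exists (b :: l0) => // c; rewrite inE => /orP[/eqP->|/l0A].
Qed.

Definition codes_tree (l : seq (nat * nat)) T := perm_eq l [seq code_arc a | a <- enum (arcs T)].

Lemma codes_treeE (l : seq (nat * nat)) T a : codes_tree l T -> (code_arc a \in l) = (a \in arcs T).
Proof. by move=> p; rewrite (perm_mem p) (mem_map code_arc_inj) mem_enum. Qed.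

(** A search inside the arcs of [T] that gets stuck has listed the whole tree in top-down order.
    This turns an arbitrarily ordered input into a growing list. *)
Lemma codes_tree_growing T r (l : seq (nat * nat)) : rooted_tree T r ->
  grows [:: val r] l -> {subset l <= [seq code_arc a | a <- enum (arcs T)]} ->
  arc_closed [seq code_arc a | a <- enum (arcs T)] (val r :: heads l) ->
  codes_tree l T.
Proof.
move=> rT + sub cl; have [l0 E sub0] := code_arc_sub sub.
rewrite E (grows_code [:: r]) => g.
have [|//|_] := closed_growing_tree rT g; last first.
- by move=> p; rewrite /codes_tree perm_map.
- move=> a aT a1; have := cl (code_arc a).
  rewrite E heads_code -map_cons !(mem_map val_inj) (mem_map code_arc_inj) mem_enum.
  by move=> /(_ aT a1).
- by move=> a /sub0; rewrite mem_enum.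
Qed.

Lemma card_set1_code (S : {set 'I_n * 'I_n}) (x : nat * nat) :
  x \in [seq code_arc a | a <- enum S] ->
  (forall a, (a \in S) = (x == code_arc a)) -> #|S| = 1.
Proof.
move=> /mapP[a aS E] H; apply/eqP/cards1P; exists a; apply/setP => b.
by rewrite H E inE (inj_eq code_arc_inj) eq_sym.
Qed.

Lemma exchange_diff T T' (l l' : seq (nat * nat)) x :
  codes_tree l T -> codes_tree l' T' -> exchange x l l' ->
  (forall a, (a \in arcs T :\: arcs T') = (x.1 == code_arc a)) /\
  #|arcs T :\: arcs T'| = 1.
Proof.
move=> cT cT' [c [p p' nx]].
have ul : uniq l by rewrite (perm_uniq cT) (map_inj_uniq code_arc_inj) enum_uniq.
have H a : (a \in arcs T :\: arcs T') = (x.1 == code_arc a).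
  rewrite inE -(codes_treeE a cT) -(codes_treeE a cT') (perm_mem p) (perm_mem p') !inE.
  move: ul; rewrite (perm_uniq p) /= => /andP[nc _].
  rewrite [_ == x.1]eq_sym; have [<-|_] := eqVneq x.1 (code_arc a).
    by rewrite (negbTE nx) (negbTE nc).
  by rewrite /=; case: (_ \in c); rewrite ?orbT ?orbF ?andbF.
split=> //; apply: (card_set1_code _ H) => //.
have : x.1 \in l by rewrite (perm_mem p) mem_head.
rewrite (perm_mem cT) => /mapP[a _ E]; apply/mapP; exists a => //.
by rewrite mem_enum H E.
Qed.

Lemma exchange_sym (x : (nat * nat) * (nat * nat)) (l l' : seq (nat * nat)) :
  exchange x l l' -> exchange (x.2, x.1) l' l.
Proof. by move=> [c [p p' nx]]; exists c; split=> //=; rewrite eq_sym. Qed.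

Lemma recon_reconf G A k Ts Tg (l l' : seq (nat * nat))
  (tr : seq ((nat * nat) * (nat * nat))) : 0 < k ->
  vset G = [set: 'I_n] -> listing A (arcs G) ->
  directed_tree_in G Ts -> directed_tree_in G Tg ->
  size l = k -> codes_tree l Ts -> codes_tree l' Tg ->
  recon [seq code_arc a | a <- A] k l tr l' ->
  exists T : nat -> digraph 'I_n, reconf_seq G Ts Tg (size tr) T /\
    forall i d, i < size tr -> forall a,
      (a \in arcs (T i) :\: arcs (T i.+1)) = ((nth d tr i).1 == code_arc a) /\
      (a \in arcs (T i.+1) :\: arcs (T i)) = ((nth d tr i).2 == code_arc a).
Proof.
move=> k0 GV lA + dg + + cg; elim: tr l Ts => [|x tr IH] l Ts ds sz cs /=.
  move=> p; exists (fun=> Ts); split=> //; split=> //.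
  apply: directed_tree_eq; [by case: ds|by case: dg| |].
    by rewrite cardE -(size_map code_arc) -(perm_size cs) sz.
  by apply/setP => a; rewrite -(codes_treeE a cs) -(codes_treeE a cg) (perm_mem p).
move=> [l1 [[r1 [g1 sz1 sub1]] ex rc]].
have [l0 E sub0] := code_arc_sub sub1.
(* As [k > 0], some arc leaves the root, so its number comes from an ordinal. *)
have [r E1] : exists r : 'I_n, r1 = val r.
  move: g1 sz1; rewrite E; case: (l0) => [|a q]; first by move=> _ k1; rewrite -k1 in k0.
  by move=> /= /andP[+ _] _; rewrite inE => /eqP <-; exists a.1.
move: g1; rewrite E E1 (grows_code [:: r]) => g1.
have rT := growing_rooted_tree g1.
have c1 : codes_tree l1 (digraph_of r l0).
  rewrite E; apply: perm_map; apply: uniq_perm (grows_uniq_arcs g1) (enum_uniq _) _ => a.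
  by rewrite mem_enum inE.
have d1 : directed_tree_in G (digraph_of r l0).
  split; first by exists r.
  split; [by case: rT|by rewrite GV; apply/subsetP => v; rewrite !inE|].
  by apply/subsetP => a; rewrite inE => /sub0; rewrite (perm_mem lA) mem_enum.
have [T [[T0 Tl Td Te] To]] := IH l1 _ d1 sz1 c1 rc.
have [D1 C1] := exchange_diff cs c1 ex.
have [D2 C2] := exchange_diff c1 cs (exchange_sym ex).
exists (fun i => if i is j.+1 then T j else Ts); split.
  split=> //; first by move=> [|i] //=; exact: Td.
  by move=> [|i] /=; [rewrite T0|exact: Te].
by move=> [|i] d /=; [rewrite T0 => _ a; split|move=> ilt; exact: To].
Qed.

(** The negative half of the decision: with [P] the labelled vertices, no sequence whatsoever
    changes the side of the root. *)
Lemma reconf_root G A k (P : nat -> Prop) Ts Tg ell (T : nat -> digraph 'I_n) rs rg : 1 < k ->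
  listing A (arcs G) ->
  (forall x v, linked [seq code_arc a | a <- A] k x v -> (P x <-> P v)) ->
  #|arcs Ts| = k -> reconf_seq G Ts Tg ell T -> rooted_tree Ts rs ->
  rooted_tree Tg rg -> (P (val rs) <-> P (val rg)).
Proof.
move=> k1 lA PA; elim: ell Ts T rs => [|ell IH] Ts T rs ks [T0 Tl Td Te] rTs rTg.
  by rewrite (rooted_tree_root_unique rTs (_ : rooted_tree Ts rg)) // -T0 Tl.
have [e1 e2] := Te 0 isT.
have [r1 rT1] : directed_tree (T 1) by case: (Td 1 isT).
have k1' : #|arcs (T 1)| = k.
  by rewrite -ks -T0 -(cardsID (arcs (T 0))) e2 -(cardsID (arcs (T 1)) (arcs (T 0))) e1 setIC.
rewrite -(IH (T 1) (fun i => T i.+1) r1) //; last first.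
  split=> // i ilt; [exact: Td|exact: Te].
have rt T' r : rooted_tree T' r -> directed_tree_in G T' -> #|arcs T'| = k ->
    exists l, rtree [seq code_arc a | a <- A] k (val r) [seq code_arc a | a <- l]
     /\ perm_eq l (enum (arcs T')).
  move=> rT' [_ [_ _ /subsetP sT']] kT'.
  have [l [g _ p]] := rooted_tree_growing rT'; exists l; split=> //; split.
  - by rewrite (grows_code [:: r]).
  - by rewrite size_map (perm_size p) -cardE.
  - move=> a /mapP[b bl ->]; rewrite (mem_map code_arc_inj) (perm_mem lA) mem_enum.
    by apply: sT'; rewrite -mem_enum -(perm_mem p).
have [l [tl pl]] : exists l, rtree [seq code_arc a | a <- A] k (val rs) [seq code_arc a | a <- l]
     /\ perm_eq l (enum (arcs Ts)) by apply: rt => //; rewrite -T0; exact: (Td 0).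
have [l' [tl' pl']] := rt _ _ rT1 (Td 1 isT) k1'.
(* A difference of size one splits an arc set into the exchanged arc and the common part, the form
   that [root_exchange] takes. *)
have dec (E E' : {set 'I_n * 'I_n}) : #|E :\: E'| = 1 -> exists a, 
    perm_eq (enum E) (a :: enum (E :&: E')).
  move=> /eqP/cards1P[a Ea]; exists a; apply: uniq_perm (enum_uniq _) _ _.
    rewrite /= enum_uniq andbT mem_enum inE.
    by have := in_set1 a a; rewrite -Ea eqxx inE => /andP[/negbTE-> _]; rewrite andbF.
  move=> b; rewrite inE !mem_enum inE; have := in_set1 b a; rewrite -Ea inE => <-.
  by case: (b \in E); case: (b \in E').
have [e pe] := dec _ _ e1; have [f pf] := dec _ _ e2.
apply: (root_exchange PA k1 tl tl' (e := code_arc e) (f := code_arc f)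
  (c := [seq code_arc a | a <- enum (arcs (T 0) :&: arcs (T 1))])).
  by rewrite -map_cons perm_map // (perm_trans pl) // -T0.
by rewrite -map_cons perm_map // (perm_trans pl') // setIC.
Qed.

End Codes.

(** * A program logic with running times *)

Local Notation cells := Defs.mem.
Local Notation Minus := Defs.Sub.

Section Wp.
Variable W : nat.
Implicit Types (c : cmd) (s : state) (Q : nat -> state -> Prop).

Definition wp c s Q := exists t s', exec W c s t s' /\ Q t s'.

Lemma wp_mono c s Q Q' : wp c s Q -> (forall t s', Q t s' -> Q' t s') -> wp c s Q'.
Proof. by move=> [t [s' [e q]]] H; exists t, s'; split=> //; exact: H. Qed.

Lemma wp_skip s Q : Q 1 s -> wp Skip s Q.
Proof. by move=> q; exists 1, s; split=> //; constructor. Qed.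

Lemma wp_assign x e s Q : Q 1 (set_reg s x (eval W s e)) -> wp (Assign x e) s Q.
Proof. by move=> q; do 2!eexists; split; [constructor|]. Qed.

Lemma wp_store a e1 e2 s Q :
  Q 1 (set_mem s a (eval W s e1) (eval W s e2)) -> wp (Store a e1 e2) s Q.
Proof. by move=> q; do 2!eexists; split; [constructor|]. Qed.

Lemma wp_seq c1 c2 s Q :
  wp c1 s (fun t1 s1 => wp c2 s1 (fun t2 s2 => Q (t1 + t2) s2)) ->
  wp (Seq c1 c2) s Q.
Proof.
move=> [t1 [s1 [e1 [t2 [s2 [e2 q]]]]]]; exists (t1 + t2), s2; split=> //.
exact: exec_seq e1 e2.
Qed.

Lemma wp_cond e c1 c2 s Q :
  wp (if eval W s e != 0 then c1 else c2) s (fun t s' => Q t.+1 s') ->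
  wp (Cond e c1 c2) s Q.
Proof. by move=> [t [s' [x q]]]; exists t.+1, s'; split=> //; constructor. Qed.

Lemma wp_while_true e c s Q : eval W s e != 0 ->
  wp c s (fun t s' => wp (While e c) s' (fun t' s'' => Q (t + t').+1 s'')) ->
  wp (While e c) s Q.
Proof.
move=> e1 [t1 [s1 [x1 [t2 [s2 [x2 q]]]]]]; exists (t1 + t2).+1, s2; split=> //.
by constructor; rewrite e1; exact: exec_seq x1 x2.
Qed.

Lemma wp_while_false e c s Q : eval W s e = 0 -> Q 2 s -> wp (While e c) s Q.
Proof. by move=> e0 q; exists 2, s; split=> //; constructor; rewrite e0; constructor. Qed.

(** Here [t] is the time spent so far. A round costs its body and one test; leaving the loop costs a
    test and the [Skip] into which the loop unfolds. *)
Lemma wp_while (I : nat -> state -> Prop) (mu : state -> nat) e c s Q :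
  I 0 s ->
  (forall t s, I t s -> eval W s e != 0 ->
     wp c s (fun t' s' => I (t + t').+1 s' /\ mu s' < mu s)) ->
  (forall t s, I t s -> eval W s e = 0 -> Q t.+2 s) ->
  wp (While e c) s Q.
Proof.
move=> I0 step stop.
have : forall N t s, mu s < N -> I t s -> wp (While e c) s (fun t' s' => Q (t + t') s').
  elim=> // N IH t s1 lt It; have [e1|/negbNE/eqP e0] := boolP (eval W s1 e != 0).
    apply: wp_while_true => //; apply: wp_mono (step _ _ It e1) _ => t' s' [I' lt'].
    have : mu s' < N by lia.
    move=> /IH/(_ I') w; apply: wp_mono w _ => t'' s''.
    by have -> : (t + t').+1 + t'' = t + (t' + t'').+1 by lia.
  by apply: wp_while_false => //; rewrite addn2; exact: stop.
by move/(_ _ 0 s (ltnSn _) I0).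
Qed.

Definition For i (N : expr) c :=
  Seq (Assign i (Const 0))
    (While (Lt (Reg i) N) (Seq c (Assign i (Add (Reg i) (Const 1))))).

Lemma eval_incr x : x.+1 < W -> (x + 1 %% W) %% W = x.+1.
Proof. by move=> xW; rewrite (@modn_small 1) ?addn1 ?modn_small //; lia. Qed.

(** The invariant counts only the time of the bodies. The rest is fixed: a test and an increment per
    round, and three steps for the initial assignment and the exit. *)
Lemma wp_for (I : nat -> nat -> state -> Prop) Nv i N c s Q :
  Nv < W ->
  (forall j t s, I j t s -> eval W s N = Nv) ->
  I 0 0 (set_reg s i 0) ->
  (forall j t s, j < Nv -> I j t s -> reg s i = j ->
     wp c s (fun t' s' => reg s' i = j /\ I j.+1 (t + t') (set_reg s' i j.+1))) ->
  (forall t s, I Nv t s -> reg s i = Nv -> Q (t + 2 * Nv + 3) s) ->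
  wp (For i N c) s Q.
Proof.
move=> NW IN I0 step stop; apply: wp_seq; apply: wp_assign; rewrite /= mod0n.
pose J t s := exists j t', [/\ j <= Nv, reg s i = j, I j t' s & t = t' + 2 * j].
apply: (@wp_while J (fun s => Nv - reg s i)).
- by exists 0, 0; rewrite /= eqxx.
- move=> t s1 [j [t' [jN ij Ij ->]]] /=; rewrite (IN _ _ _ Ij) ij.
  have [lt _|//] := ltnP j Nv; apply: wp_seq; apply: wp_mono (step _ _ _ lt Ij ij) _.
  move=> t1 s2 [ij2 Ij2]; apply: wp_assign => /=; rewrite ij2 eval_incr; last by lia.
  split; last by rewrite /= eqxx; lia.
  exists j.+1, (t' + t1); rewrite /= eqxx; split=> //; lia.
- move=> t s1 [j [t' [jN ij Ij ->]]] /=; rewrite (IN _ _ _ Ij) ij.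
  have [//|ge _] := ltnP j Nv; have E : j = Nv by lia.
  rewrite E in Ij ij *.
  have := stop _ _ Ij ij.
  by have -> : t' + 2 * Nv + 3 = 1 + (t' + 2 * Nv).+2 by lia.
Qed.

Lemma wp_forc b (I : nat -> state -> Prop) Nv i N c s Q :
  Nv < W ->
  (forall j s, I j s -> eval W s N = Nv) ->
  I 0 (set_reg s i 0) ->
  (forall j s, j < Nv -> I j s -> reg s i = j ->
     wp c s (fun t' s' => [/\ t' <= b, reg s' i = j & I j.+1 (set_reg s' i j.+1)])) ->
  (forall t s, t <= (b + 2) * Nv + 3 -> I Nv s -> Q t s) ->
  wp (For i N c) s Q.
Proof.
move=> NW IN I0 step stop.
apply: (@wp_for (fun j t s => I j s /\ t <= b * j) Nv) => //.
- by move=> j t s1 [Ij _]; exact: IN Ij.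
- move=> j t s1 lt [Ij tj] ij; apply: wp_mono (step _ _ lt Ij ij) _.
  by move=> t' s' [t'b ij' Ij']; split=> //; split=> //; rewrite mulnS; lia.
- by move=> t s1 [Ij tj] ij; apply: stop => //; lia.
Qed.

(** * What a command leaves unchanged *)

Definition frame (rs ms : seq nat) s s' :=
  (forall x, x \notin rs -> reg s' x = reg s x) /\
  (forall a j, a \notin ms -> cells s' a j = cells s a j).

Lemma frame_refl rs ms s : frame rs ms s s.
Proof. by []. Qed.

Lemma frame_reg rs ms s s' x v : x \in rs -> frame rs ms s s' ->
  frame rs ms s (set_reg s' x v).
Proof.
move=> xr [R M]; split=> [y yr|a j am] /=; last exact: M.
by rewrite -(R _ yr); case: eqP => // E; rewrite E xr in yr.
Qed.

Lemma frame_mem rs ms s s' a i v : a \in ms -> frame rs ms s s' ->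
  frame rs ms s (set_mem s' a i v).
Proof.
move=> am [R M]; split=> [y yr|b j bm] /=; first exact: R.
by rewrite -(M _ _ bm); case: eqP => //= E; rewrite E am in bm.
Qed.

Lemma frame_sub rs ms rs' ms' s s' : frame rs' ms' s s' ->
  all [in rs] rs' -> all [in ms] ms' -> frame rs ms s s'.
Proof.
move=> [R M] /allP sr /allP sm; split=> [x xr|a j am].
  by rewrite R //; apply: contra xr; exact: sr.
by rewrite M //; apply: contra am; exact: sm.
Qed.

Lemma frame_trans rs ms s s' s'' : frame rs ms s s' -> frame rs ms s' s'' ->
  frame rs ms s s''.
Proof. by move=> [R M] [R' M']; split=> [x xr|a j am]; rewrite ?R' ?M' ?R ?M. Qed.

End Wp.

Ltac wps := repeat first
  [apply: wp_seq | apply: wp_assign | apply: wp_store | apply: wp_skip].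
Ltac frm := repeat first [assumption | exact: frame_refl
  | apply: frame_reg; first by [] | apply: frame_mem; first by []].
Ltac nlia :=
  repeat match goal with
  | H : ?P |- _ => match type of P with Prop =>
      lazymatch P with
      | is_true (leq _ _) => fail | @eq nat _ _ => fail | _ => clear H
      end end
  end; lia.

(** * Subroutines *)

Implicit Types (A l D : seq (nat * nat)) (s : state).
Implicit Types (tr : seq ((nat * nat) * (nat * nat))).
Local Notation arc0 := (0, 0).

(* Memory map.  A tree with root r and arcs a_1, a_2, ... occupies a pair of
   arrays with a_i.1 at index i of the first one, a_i.2 at index i of the second
   one, and r at index 0 of the second one.
   - 0..7: the input; 0..3 are reused for the exchanges;
   - 10, 11: head of each arc, and link to the next arc with the same tail
     (links and list heads are arc indices plus one, with 0 for the end);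
   - 12, 13, 14: list heads for G, Ts and Tg;
   - 15: visited vertices; 16, 17: the tree found by the last search;
   - 18, 19: the current tree; 20, 21: the goal tree;
   - 22, 23: the tree obtained from 16, 17 by adding an arc into its root;
   - 24: number of arcs of the search tree from each vertex, at most k;
   - 25, 26, 27: label of a vertex (0 if unlabelled), the vertex through which
     it was labelled, and whether the arc used leaves that vertex;
   - 28, 29: parent plus one in the current tree, and vertices settled by morph.
   Registers 6 and 7 hold the current root and the goal root, register 8 the
   number of exchanges made so far. *)

Fixpoint linked_list (nx : nat -> nat) x (js : seq nat) :=
  if js is j :: js' then x = j.+1 /\ linked_list nx (nx j) js' else x = 0.

Lemma linked_list_eq nx nx' x js : {in js, nx =1 nx'} ->
  linked_list nx x js -> linked_list nx' x js.
Proof.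
elim: js x => [|j js IH] x //= E [-> L]; split=> //; rewrite -E ?mem_head //.
by apply: IH L => i ij; apply: E; rewrite inE ij orbT.
Qed.

(** Reversed because [build] inserts each arc at the front of the list of its tail. *)
Definition outs A i u := rev [seq j <- iota 0 i | (nth arc0 A j).1 == u].

Lemma outsS A i u :
  outs A i.+1 u = if (nth arc0 A i).1 == u then i :: outs A i u else outs A i u.
Proof.
rewrite /outs -addn1 iotaD filter_cat rev_cat /= add0n.
by case: ifP.
Qed.

Lemma mem_outs A i u j : (j \in outs A i u) = (j < i) && ((nth arc0 A j).1 == u).
Proof. by rewrite mem_rev mem_filter mem_iota andbC. Qed.

Lemma sum_count_uniq (q js : seq nat) (g : nat -> nat) : uniq q ->
  \sum_(v <- q) count (fun j => g j == v) js <= size js.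
Proof.
move=> uq; elim: js => [|j js IH] /=; first by rewrite big1.
rewrite big_split /= -addn1 addnC; apply: leq_add => //.
suff -> : \sum_(v <- q) (g j == v) = count_mem (g j) q.
  by rewrite count_uniq_mem // leq_b1.
by rewrite -sum1_count [RHS]big_mkcond /=; apply: eq_bigr => v _; rewrite eq_sym; case: eqP.
Qed.

(** Every arc has a single tail, so distinct vertices have disjoint lists. This makes a search
    linear in the number of arcs. *)
Lemma sum_outs A q : uniq q -> \sum_(v <- q) size (outs A (size A) v) <= size A.
Proof.
move=> uq; have := @sum_count_uniq q (iota 0 (size A)) (fun j => (nth arc0 A j).1) uq.
rewrite size_iota; congr (_ <= _); apply: eq_bigr => v _.
by rewrite size_rev size_filter.
Qed.

Definition adj A i f s :=
  (forall u, linked_list (cells s 11) (cells s f u) (outs A i u)) /\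
  forall j, j < i -> cells s 10 j = (nth arc0 A j).2.

Definition stored at_ ah A s := forall i, i < size A ->
  (cells s at_ i, cells s ah i) = nth arc0 A i.

Definition tree_at at_ ah r l s := cells s ah 0 = r /\
  forall i, i < size l -> (cells s at_ i.+1, cells s ah i.+1) = nth arc0 l i.

Definition build f ts hs N :=
  For 20 N (Seq (Store 11 (Reg 20) (Cell f (Cell ts (Reg 20))))
           (Seq (Store 10 (Reg 20) (Cell hs (Reg 20)))
                (Store f (Cell ts (Reg 20)) (Add (Reg 20) (Const 1))))).

Lemma wp_build W f ts hs rN A s :
  f \in [:: 12; 13; 14] -> ts < 8 -> hs < 8 -> rN < 20 ->
  (size A).+1 < W -> reg s rN = size A -> stored ts hs A s ->
  (forall j, cells s f j = 0) ->
  wp W (build f ts hs (Reg rN)) s (fun t s' =>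
    [/\ t <= 5 * size A + 3, frame [:: 20] [:: 10; 11; f] s s' &
        adj A (size A) f s']).
Proof.
move=> f3 ts8 hs8 rN20 AW rA st f0.
have [f10 f11 fts fhs] : [/\ f != 10, f != 11, ts != f & hs != f].
  by move: f3; rewrite !inE => /or3P[]/eqP->; split=> //; lia.
apply: (@wp_forc W 3 (fun i s' => frame [:: 20] [:: 10; 11; f] s s' /\ adj A i f s')
  (size A)); [lia| | | |].
- move=> j s1 [F _] /=; rewrite F.1 ?rA // inE; lia.
- split; first frm.
  by split=> // u; rewrite /= f0.
- move=> i s1 iA [F [L H]] ij; wps.
  have tsE : cells s1 ts i = (nth arc0 A i).1.
    by rewrite F.2 -?(st _ iA) // !inE (negbTE fts); lia.
  have hsE : cells s1 hs i = (nth arc0 A i).2.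
    by rewrite F.2 -?(st _ iA) // !inE (negbTE fhs); lia.
  split; [by []|by []|].
  split.
    by do 4 (try (apply: frame_reg; first by []); try (apply: frame_mem; first by rewrite !inE eqxx ?orbT)).
  have t10 : (ts == 10) = false by lia.
  have t11 : (ts == 11) = false by lia.
  have h11 : (hs == 11) = false by lia.
  rewrite /adj /= !ij t10 t11 h11 /= tsE hsE eval_incr; last lia.
  rewrite (negbTE f10) (negbTE f11) /=.
  rewrite ![10 == f]eq_sym ![11 == f]eq_sym (negbTE f10) (negbTE f11) eqxx /=.
  split=> [u|j]; last first.
    by rewrite ltnS leq_eqVlt; case: eqP => [->|_] //= /H ->.
  rewrite outsS eq_sym; case: eqP => [<-|_] /=.
    rewrite eqxx; split=> //; apply: linked_list_eq (L _) => j.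
    by rewrite mem_outs => /andP[ji _]; rewrite ltn_eqF.
  apply: linked_list_eq (L _) => j.
  by rewrite mem_outs => /andP[ji _]; rewrite ltn_eqF.
- by move=> t s1 tb [F ad]; split=> //; lia.
Qed.

(** Register 2 holds the number [k + 1] of vertices of the tree, so the root at index 0 is copied
    together with the [k] arcs. *)
Definition copy a b := For 20 (Reg 2) (Store b (Reg 20) (Cell a (Reg 20))).

Lemma wp_copy W a b s k : a != b -> k.+1 < W -> reg s 2 = k.+1 ->
  wp W (copy a b) s (fun t s' => [/\ t <= 3 * k.+1 + 3,
    frame [:: 20] [:: b] s s' & forall i, i <= k -> cells s' b i = cells s a i]).
Proof.
move=> ab kW r2.
apply: (@wp_forc W 1 (fun i s' => frame [:: 20] [:: b] s s' /\
   forall j, j < i -> cells s' b j = cells s a j) k.+1); [lia| | | |].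
- by move=> j s1 [F _] /=; rewrite F.1.
- by split=> //; frm.
- move=> i s1 ik [F E] ij; wps; rewrite /= ij; split=> //.
  split; first by apply: frame_reg => //; apply: frame_mem; rewrite ?inE.
  move=> j; rewrite ltnS leq_eqVlt /= eqxx /=; case: eqP => [->|_] //=; last exact: E.
  by rewrite F.2 // inE.
- by move=> t s1 tb [F E]; split=> //; lia.
Qed.

Lemma wp_copy_tree W at_ ah bt bh r l s :
  at_ \notin [:: bt; bh] -> ah \notin [:: bt; bh] -> bt != bh ->
  (size l).+1 < W -> reg s 2 = (size l).+1 -> tree_at at_ ah r l s ->
  wp W (Seq (copy at_ bt) (copy ah bh)) s (fun t s' => [/\ t <= 6 * size l + 12,
    frame [:: 20] [:: bt; bh] s s' & tree_at bt bh r l s']).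
Proof.
rewrite !inE !negb_or => /andP[a1 a2] /andP[a3 a4] b12 lW r2 [E0 E].
apply: wp_seq; apply: wp_mono (wp_copy a1 lW r2) _ => t1 s1 [T1 F1 E1].
have r2' : reg s1 2 = (size l).+1 by rewrite F1.1.
apply: wp_mono (wp_copy a4 lW r2') _ => t2 s2 [T2 F2 E2]; split; first lia.
- by apply: (@frame_trans _ _ _ s1); [apply: frame_sub F1 _ _|apply: frame_sub F2 _ _];
    rewrite //= !inE ?eqxx ?orbT.
- have X i : i <= size l -> cells s1 ah i = cells s ah i.
    by move=> _; rewrite F1.2 // inE.
  split=> [|i il]; first by rewrite E2 // X.
  by rewrite E2 // X // F2.2 ?inE // E1 // E.
Qed.

Lemma tree_at_eq at_ ah r l s s' :
  (forall j, cells s' at_ j.+1 = cells s at_ j.+1) ->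
  (forall j, cells s' ah j = cells s ah j) ->
  tree_at at_ ah r l s -> tree_at at_ ah r l s'.
Proof. by move=> E1 E2 [E H]; split=> [|i il]; rewrite ?E1 ?E2 ?H. Qed.

Lemma tree_at_frame rs ms at_ ah r l s s' : frame rs ms s s' ->
  at_ \notin ms -> ah \notin ms -> tree_at at_ ah r l s -> tree_at at_ ah r l s'.
Proof. by move=> F m1 m2; apply: tree_at_eq => j; rewrite F.2. Qed.

Lemma tree_at_rcons at_ ah r l a s s' :
  (forall j, cells s' at_ j = if j == (size l).+1 then a.1 else cells s at_ j) ->
  (forall j, cells s' ah j = if j == (size l).+1 then a.2 else cells s ah j) ->
  tree_at at_ ah r l s -> tree_at at_ ah r (rcons l a) s'.
Proof.
move=> E1 E2 [E H]; split=> [|i]; rewrite ?E1 ?E2 //.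
rewrite size_rcons ltnS leq_eqVlt nth_rcons eqSS.
by case: ltngtP => //= [il _|_ _]; rewrite ?H //; case: (a).
Qed.

Lemma tree_at_head at_ ah r l s i : tree_at at_ ah r l s -> i <= size l ->
  cells s ah i = nth 0 (r :: heads l) i.
Proof.
move=> [E H]; case: i => [|i] il //=; rewrite /heads (nth_map arc0) //.
by rewrite -H.
Qed.

(** * Search until [k] arcs are found *)

Definition scan :=
  While (Reg 14)
    (Seq (Assign 15 (Cell 10 (Minus (Reg 14) (Const 1))))
    (Seq (Cond (Cell 15 (Reg 15)) Skip
           (Cond (Lt (Reg 11) (Reg 3))
             (Seq (Assign 11 (Add (Reg 11) (Const 1)))
             (Seq (Store 16 (Reg 11) (Reg 13))
             (Seq (Store 17 (Reg 11) (Reg 15))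
                  (Store 15 (Reg 15) (Const 1)))))
             Skip))
         (Assign 14 (Cell 11 (Minus (Reg 14) (Const 1)))))).

(** Array 17 doubles as the queue: the root is entry 0, the heads follow in order of discovery, and
    register 12 points to the next vertex to scan. The final loop erases exactly the marks that were
    set. *)
Definition bfs f :=
  Seq (Assign 11 (Const 0))
  (Seq (Store 17 (Const 0) (Reg 10))
  (Seq (Store 15 (Reg 10) (Const 1))
  (Seq (Assign 12 (Const 0))
  (Seq (While (Lt (Reg 12) (Add (Reg 11) (Const 1)))
         (Seq (Assign 13 (Cell 17 (Reg 12)))
         (Seq (Assign 14 (Cell f (Reg 13)))
         (Seq scan
              (Assign 12 (Add (Reg 12) (Const 1)))))))
       (For 16 (Add (Reg 11) (Const 1)) (Store 15 (Cell 17 (Reg 16)) (Const 0))))))).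

Definition searching A k h D s :=
  [/\ grows [:: h] D, {subset D <= A} & size D <= k] /\
  [/\ tree_at 16 17 h D s, reg s 11 = size D &
      forall v, cells s 15 v = (v \in h :: heads D)].

(** Nine steps per arc is the cost of the longest branch, the one that adds the arc to the tree. *)
Lemma wp_scan W A k h u js D s :
  k.+2 < W -> reg s 3 = k -> reg s 13 = u -> u \in h :: heads D ->
  linked_list (cells s 11) (reg s 14) js ->
  (forall j, j \in js -> j < size A /\ (nth arc0 A j).1 = u) ->
  (forall j, j < size A -> cells s 10 j = (nth arc0 A j).2) ->
  searching A k h D s ->
  wp W scan s (fun t s' => exists E,
    [/\ t <= 9 * size js + 2, frame [:: 11; 14; 15] [:: 15; 16; 17] s s',
        searching A k h (D ++ E) s' &
        size (D ++ E) = k \/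
        forall j, j \in js -> (nth arc0 A j).2 \in h :: heads (D ++ E)]).
Proof.
move=> kW; elim: js s D => [|j js IH] s D k3 r13 uD /=.
  move=> r14 _ _ sD; apply: wp_while_false => //; exists [::]; rewrite cats0.
  by split=> //; right.
move=> [r14 L] jA H10 sD.
have [jlt ju] := jA _ (mem_head _ _).
have jA' i : i \in js -> i < size A /\ (nth arc0 A i).1 = u.
  by move=> ij; apply: jA; rewrite inE ij orbT.
have [[g sub szD] [tD r11 M]] := sD.
apply: wp_while_true => /=; first by rewrite r14.
apply: wp_seq; apply: wp_assign => /=.
rewrite r14 modn_small ?subn1 /=; last lia.
rewrite H10 //; set w := (nth arc0 A j).2.
apply: wp_seq; apply: wp_cond => /=; rewrite M.
case: (boolP (w \in h :: heads D)) => wD /=.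
  apply: wp_skip; apply: wp_assign => /=; rewrite r14 modn_small ?subn1 /=; last lia.
  set s1 := set_reg _ _ _.
  apply: wp_mono (IH s1 D _ _ _ _ _ _ _) _ => //.
  move=> t s' [E [tb F S C]]; exists E; split=> //; first lia.
    by apply: frame_trans F; frm.
  case: C => [|C]; [by left|right=> i].
  rewrite inE => /orP[/eqP->|]; last exact: C.
  by rewrite -/w /heads map_cat -cat_cons mem_cat wD.
apply: wp_cond => /=; rewrite r11 k3.
have [lt|ge] := ltnP (size D) k => /=; last first.
  apply: wp_skip; apply: wp_assign => /=; rewrite r14 modn_small ?subn1 /=; last lia.
  set s1 := set_reg _ _ _.
  apply: wp_mono (IH s1 D _ _ _ _ _ _ _) _ => //.
  move=> t s' [E [tb F S C]]; exists E; split=> //; first lia.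
    by apply: frame_trans F; frm.
  left; have [[_ _ +] _] := S; rewrite size_cat; lia.
wps => /=; rewrite r11 eval_incr; last lia.
rewrite r14 !modn_small ?subn1 /=; try lia.
set s1 := set_reg _ _ _; set a := (u, w).
have aA : a \in A by rewrite /a -ju -surjective_pairing mem_nth.
have hD : heads (rcons D a) =i w :: heads D by move=> z; rewrite /heads map_rcons mem_rcons.
have S1 : searching A k h (rcons D a) s1.
  split; [split|split].
  - rewrite grows_rcons g /= !mem_cat ![_ || (_ \in [:: h])]orbC.
    by rewrite -!mem_cat /= uD.
  - by move=> b; rewrite mem_rcons inE => /orP[/eqP->|/sub].
  - by rewrite size_rcons.
  - by apply: tree_at_rcons tD => i /=; rewrite ?r13.
  - by rewrite /= size_rcons.
  - move=> v; rewrite /= [RHS](_ : _ = (v == w) || (v \in h :: heads D) :> nat).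
      by case: eqP => //= _; rewrite M.
    by rewrite inE hD !inE; case: (v == h); case: (v == w).
apply: wp_mono (IH s1 (rcons D a) _ _ _ _ _ _ _) _ => //.
  by rewrite inE hD; move: uD; rewrite !inE => /orP[->|->]; rewrite ?orbT.
move=> t s' [E [tb F S C]]; exists (a :: E); rewrite -cat_rcons; split=> //; first lia.
  by apply: frame_trans F; frm.
case: C => [|C]; [by left|right=> i].
rewrite inE => /orP[/eqP->|]; last exact: C.
by rewrite -/w inE /heads map_cat mem_cat -/(heads _) hD mem_head /= orbT.
Qed.

Definition search_tree A k h D :=
  [/\ grows [:: h] D, {subset D <= A}, size D <= k &
      size D = k \/ arc_closed A (h :: heads D)].

Lemma wp_bfs W f A k h s :
  f \in [:: 12; 13; 14] -> k.+2 < W -> reg s 3 = k -> reg s 10 = h ->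
  adj A (size A) f s -> (forall j, cells s 15 j = 0) ->
  wp W (bfs f) s (fun t s' => exists D,
    [/\ t <= 20 * size A + 20 * k + 30,
        frame [:: 11; 12; 13; 14; 15; 16] [:: 15; 16; 17] s s',
        forall j, cells s' 15 j = 0,
        search_tree A k h D & tree_at 16 17 h D s' /\ reg s' 11 = size D]).
Proof.
move=> f3 kW r3 r10 [L H10] M0.
have [f15 f16 f17] : [/\ f != 15, f != 16 & f != 17].
  by move: f3; rewrite !inE => /or3P[]/eqP->.
apply: wp_seq; apply: wp_assign; apply: wp_seq; apply: wp_store.
apply: wp_seq; apply: wp_store; apply: wp_seq; apply: wp_assign => /=.
rewrite r10 !mod0n modn_small; last lia.
set s0 := set_reg _ _ _.
have F0 : frame [:: 11; 12; 13; 14; 15; 16] [:: 15; 16; 17] s s0 by frm.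
(* The first [p] queue entries are done. Each is charged for its outgoing arcs, so that [sum_outs]
   bounds the total. *)
pose I t s' := exists D p,
  [/\ frame [:: 11; 12; 13; 14; 15; 16] [:: 15; 16; 17] s s',
      searching A k h D s', reg s' 12 = p /\ p <= (size D).+1,
      t <= 10 * p + 9 * \sum_(v <- take p (h :: heads D)) size (outs A (size A) v) &
      size D = k \/
      forall a, a \in A -> a.1 \in take p (h :: heads D) -> a.2 \in h :: heads D].
apply: wp_seq; apply: (@wp_while _ I (fun s' => k.+1 - reg s' 12)).
- exists [::], 0; split=> //; last by right.
  split; [by []|split=> // v].
  by rewrite /= M0 inE; case: eqP.
- move=> t s1 [D [p [F S [r12 pD] tb C]]] /=.
  have [[g sub szD] [tD r11 M]] := S.
  rewrite r12 r11 eval_incr; last lia.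
  case: (ltnP p (size D).+1) => // plt _; wps => /=.
  set u := cells s1 17 (reg s1 12).
  have uE : u = nth 0 (h :: heads D) p by rewrite /u r12 (tree_at_head tD).
  have psz : p < size (h :: heads D) by rewrite /= size_map.
  have uD : u \in h :: heads D by rewrite uE mem_nth.
  apply: wp_mono (@wp_scan W A k h u (outs A (size A) u) D _ kW _ _ uD _ _ _ _) _ => //=.
  + by rewrite F.1.
  + rewrite !F.2 ?inE ?negb_or ?f15 ?f16 //.
    by apply: linked_list_eq (L u) => j _; rewrite F.2.
  + by move=> j; rewrite mem_outs => /andP[-> /eqP->].
  + by move=> j jA; rewrite F.2 // H10.
  move=> t1 s2 [E [tb1 F1 S1 C1]]; apply: wp_assign => /=.
  have r12' : reg s2 12 = p by rewrite F1.1.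
  rewrite r12' eval_incr; last lia.
  have tk q : q <= (size D).+1 -> take q (h :: heads (D ++ E)) = take q (h :: heads D).
    by move=> qD; rewrite /heads map_cat -cat_cons takel_cat //= size_map.
  have tkS : take p.+1 (h :: heads D) = rcons (take p (h :: heads D)) u.
    by rewrite uE -take_nth.
  have szE : size D <= size (D ++ E) by rewrite size_cat leq_addr.
  split; last by rewrite /=; lia.
  exists (D ++ E), p.+1; split.
  + apply: frame_reg => //; apply: frame_trans F _.
    apply: (@frame_trans _ _ _ (set_reg (set_reg s1 13 u) 14 (cells s1 f u))); first frm.
    exact: frame_sub F1 _ _.
  + by case: S1 => H [H1 H2 H3]; split.
  + by split=> //=; lia.
  + rewrite tk; last lia.
    by rewrite tkS -cats1 big_cat big_seq1 /=; lia.
  + have [[_ _ szDE] _] := S1.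
    case: C => [Dk|C]; first by left; lia.
    case: C1 => [|C1]; [by left|right=> a aA].
    rewrite tk ?tkS; last lia.
    rewrite mem_rcons inE => /orP[/eqP a1|a1].
      have iA : index a A < size A by rewrite index_mem.
      have := C1 (index a A); rewrite nth_index //; apply.
      by rewrite mem_outs iA nth_index // a1 eqxx.
    by rewrite /heads map_cat -cat_cons mem_cat (C a).
- move=> t s1 [D [p [F S [r12 pD] tb C]]] /=.
  have [[g sub szD] [tD r11 M]] := S.
  rewrite r12 r11 eval_incr; last lia.
  case: (ltnP p (size D).+1) => // pge _.
  have szE : size (h :: heads D) = (size D).+1 by rewrite /= size_map.
  have pE : p = size (h :: heads D) by rewrite szE; lia.
  rewrite pE take_size in tb C.
  have tb' : t <= 10 * k + 10 + 9 * size A.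
    have sA := sum_outs A (grows_uniq_root g).
    move: (\sum_(v <- h :: heads D) _) sA tb => x; rewrite szE; lia.
  apply: (@wp_forc W 1 (fun i s' =>
      frame [:: 16] [:: 15] s1 s' /\
      forall v, cells s' 15 v = (v \in drop i (h :: heads D))) (size D).+1).
  + lia.
  + by move=> j s' [F' _] /=; rewrite F'.1 // r11 eval_incr; lia.
  + split; first by frm.
    by move=> v; rewrite drop0 /= M.
  + move=> i s' iD [F' M'] r16; wps; rewrite /= r16; split=> //; split; first frm.
    move=> v; rewrite /= F'.2 // (tree_at_head tD) // mod0n.
    have isz : i < size (h :: heads D) by rewrite /= size_map.
    have := drop_nth 0 isz; rewrite M' => ->; rewrite [in RHS]/= inE.
    have := drop_uniq i (grows_uniq_root g); rewrite (drop_nth 0 isz) /=.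
    by case: eqP => [->|] //= /andP[/negbTE->].
  + move=> t2 s2 tb2 [F2 M2]; exists D; split.
    * lia.
    * by apply: frame_trans F _; exact: frame_sub F2 _ _.
    * by move=> j; rewrite M2 drop_oversize //= size_map.
    * by split.
    * by split; [exact: tree_at_frame F2 _ _ tD|rewrite F2.1].
Qed.

(** * Output of exchanges *)

Definition emitted tr s := reg s 8 = size tr /\ forall i, i < size tr ->
  ((cells s 0 i, cells s 1 i), (cells s 2 i, cells s 3 i)) = nth (arc0, arc0) tr i.

Lemma emitted_frame rs ms tr s s' : frame rs ms s s' -> 8 \notin rs ->
  (forall a, a < 4 -> a \notin ms) -> emitted tr s -> emitted tr s'.
Proof.
move=> F r8 m4 [E H]; split=> [|i il]; first by rewrite F.1.
by rewrite !F.2 ?m4 ?H.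
Qed.

Definition emit :=
  Seq (Store 0 (Reg 8) (Reg 30)) (Seq (Store 1 (Reg 8) (Reg 31))
  (Seq (Store 2 (Reg 8) (Reg 32)) (Seq (Store 3 (Reg 8) (Reg 33))
  (Assign 8 (Add (Reg 8) (Const 1)))))).

Lemma wp_emit W tr s : emitted tr s -> (size tr).+1 < W ->
  wp W emit s (fun t s' => [/\ t <= 5, frame [:: 8] [:: 0; 1; 2; 3] s s' &
    emitted (rcons tr ((reg s 30, reg s 31), (reg s 32, reg s 33))) s']).
Proof.
move=> [E H] trW; wps => /=; rewrite E eval_incr //; split=> //; first frm.
split=> [|i]; first by rewrite size_rcons.
rewrite size_rcons ltnS leq_eqVlt nth_rcons /=.
by case: ltngtP => //= il _; rewrite ?H.
Qed.

(** * Adding an arc into the root *)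

Definition link :=
  Seq (Store 23 (Const 0) (Reg 25))
  (Seq (Store 22 (Const 1) (Reg 25))
  (Seq (Store 23 (Const 1) (Reg 10))
  (Seq (Assign 26 (Cell 16 (Reg 11)))
  (Seq (Assign 27 (Cell 17 (Reg 11)))
  (Seq (Assign 29 (Const 1))
  (For 20 (Reg 11)
    (Cond (Eq (Cell 17 (Add (Reg 20) (Const 1))) (Reg 25))
      (Seq (Assign 26 (Cell 16 (Add (Reg 20) (Const 1))))
           (Assign 27 (Cell 17 (Add (Reg 20) (Const 1)))))
      (Cond (Lt (Reg 29) (Reg 3))
        (Seq (Assign 29 (Add (Reg 29) (Const 1)))
        (Seq (Store 22 (Reg 29) (Cell 16 (Add (Reg 20) (Const 1))))
             (Store 23 (Reg 29) (Cell 17 (Add (Reg 20) (Const 1))))))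
        Skip)))))))).

(** Registers 26 and 27 start with the last arc and are overwritten if an arc into [x] turns up, as
    in [evict]. [D] may have only [k - 1] arcs, hence the cap [k.-1], which gives [rest x D] just
    when [D] has [k] arcs or the arc into [x] leaves no more. *)
Lemma wp_link W k h x D s : 0 < k -> k.+2 < W -> reg s 3 = k -> reg s 10 = h ->
  reg s 25 = x -> reg s 11 = size D -> 0 < size D <= k -> uniq (heads D) ->
  tree_at 16 17 h D s ->
  wp W link s (fun t s' => [/\ t <= 7 * k + 9,
    frame [:: 20; 26; 27; 29] [:: 22; 23] s s',
    tree_at 22 23 x ((x, h) :: take k.-1 [seq a <- D | a.2 != x]) s' &
    (reg s' 26, reg s' 27) = evict x D]).
Proof.
move=> k0 kW r3 r10 r25 r11 /andP[D0 Dk] uD tD.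
do 6!(apply: wp_seq; first [apply: wp_assign | apply: wp_store]).
rewrite /= r11 r10 r25 mod0n (@modn_small 1); last lia.
set s0 := set_reg _ _ _.
pose F i := take k.-1 [seq a <- take i D | a.2 != x].
apply: (@wp_forc W 5 (fun i s' => [/\ frame [:: 20; 26; 27; 29] [:: 22; 23] s s',
   tree_at 22 23 x ((x, h) :: F i) s', reg s' 29 = (size (F i)).+1 &
   (reg s' 26, reg s' 27) = head (last (x, x) D) [seq a <- take i D | a.2 == x]])
  (size D)); first lia.
- by move=> j s1 [Fr _ _ _] /=; rewrite Fr.1 // r11.
- rewrite /F take0 /=; split=> //; first frm.
    by split=> //= -[].
  have := tD.2 (size D).-1; rewrite prednK //= => ->; last lia.
  by rewrite nth_last; case: (D) D0.
- move=> i s1 iD [Fr T r29 ev] r20; apply: wp_cond => /=; rewrite r20 eval_incr; last lia.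
  rewrite !Fr.1 // r25.
  have [E1 E2] : cells s1 16 i.+1 = (nth arc0 D i).1 /\ cells s1 17 i.+1 = (nth arc0 D i).2.
    by rewrite !Fr.2 // -tD.2.
  have tS : take i.+1 D = rcons (take i D) (nth arc0 D i) by rewrite -take_nth.
  rewrite E2 eqb0 negbK; case: eqP => [Ex|/eqP Ex] /=.
    wps => /=; rewrite r20 eval_incr; last lia.
    split=> //; split.
    + frm.
    + have -> : F i.+1 = F i by rewrite /F tS filter_rcons Ex eqxx.
      exact: tree_at_eq T.
    + by rewrite /= /F tS filter_rcons Ex eqxx.
    + rewrite /= E1 E2 -surjective_pairing tS filter_rcons Ex eqxx.
      rewrite filter_headN //; have := uD.
      rewrite -{1}(cat_take_drop i D) (drop_nth arc0 iD) /heads map_cat cat_uniq /=.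
      by rewrite negb_or => /and3P[_ /andP[+ _] _]; rewrite Ex.
  have FS : F i.+1 = if size (F i) < k.-1 then rcons (F i) (nth arc0 D i) else F i.
    rewrite /F tS filter_rcons Ex; set q := filter _ _.
    have [qk|qk] := ltnP (size q) k.-1.
      by rewrite take_oversize ?size_rcons // take_oversize ?qk //; lia.
    rewrite size_takel ?ltnn //.
    by rewrite -cats1 takel_cat.
  have evS : [seq a <- take i.+1 D | a.2 == x] = [seq a <- take i D | a.2 == x].
    by rewrite tS filter_rcons (negbTE Ex).
  apply: wp_cond => /=; rewrite r29 Fr.1 // r3.
  have -> : ((size (F i)).+1 < k) = (size (F i) < k.-1) by lia.
  move: FS; case: (ltnP (size (F i)) k.-1) => [lt|ge] FS /=; last first.
    apply: wp_skip; split=> //; split; rewrite ?FS ?evS //=; first frm.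
  wps => /=; rewrite r20 r29 !eval_incr; try lia.
  split=> //; split; rewrite ?evS //=.
  + frm.
  + by rewrite FS -rcons_cons; apply: tree_at_rcons T => j /=; rewrite ?E1 ?E2.
  + by rewrite FS size_rcons.
- move=> t s1 tb [Fr T r29 ev]; split=> //; first nia.
    by move: T; rewrite /F take_size.
  by rewrite ev take_size.
Qed.

(** * Changing a tree into another one with the same root *)

Definition drop_kept := While (Cell 29 (Cell 19 (Reg 28))) (Assign 28 (Minus (Reg 28) (Const 1))).

Lemma filter_take_pred (T : Type) (x0 : T) (P : pred T) (l : seq T) j : 0 < j <= size l ->
  [seq a <- take j l | P a] =
  if P (nth x0 l j.-1) then rcons [seq a <- take j.-1 l | P a] (nth x0 l j.-1)
  else [seq a <- take j.-1 l | P a].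
Proof.
move=> /andP[j0 jl]; rewrite -{1}(prednK j0) (take_nth x0) ?filter_rcons //; lia.
Qed.

(** The arcs passed over have settled heads, and settled vertices stay settled, so they never have
    to be revisited. The time is stated as a difference of pointers so that it telescopes over all
    calls. *)
Lemma wp_drop_kept W r l (C : pred nat) j s : 1 < W -> reg s 28 = j -> j <= size l ->
  tree_at 18 19 r l s -> (forall v, cells s 29 v = C v) ->
  [seq a <- take j l | ~~ C a.2] != [::] ->
  wp W drop_kept s (fun t s' => exists2 j', [/\ t <= 2 * (j - j') + 2, 0 < j' <= j,
     frame [:: 28] [::] s s' & reg s' 28 = j'] &
     [seq a <- take j l | ~~ C a.2] =
       rcons [seq a <- take j'.-1 l | ~~ C a.2] (nth arc0 l j'.-1)).
Proof.
move=> W1; elim: j s => [|j IH] s r28 jl tl Inc; first by rewrite take0.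
have hE : cells s 19 (reg s 28) = (nth arc0 l j).2.
  by rewrite r28 -(tl.2 _ jl).
have := @filter_take_pred _ arc0 (fun a => ~~ C a.2) l j.+1; rewrite /= => /(_ jl) ->.
case: ifP => [nC|/negbFE iC] q0.
  apply: wp_while_false; first by rewrite /= hE Inc (negbTE nC).
  by exists j.+1; split=> //; lia.
apply: wp_while_true; first by rewrite /= hE Inc iC.
apply: wp_assign; rewrite /= r28 modn_small // subn1 /=.
set s1 := set_reg _ _ _.
apply: wp_mono (IH s1 _ _ _ _ _) _ => //; first lia.
move=> t s' [j' [tb jj F rj] E]; exists j' => //; split=> //; try lia.
by apply: frame_trans F; frm.
Qed.

Definition morph_step tt th :=
  Seq (Assign 32 (Cell tt (Add (Reg 20) (Const 1))))
  (Seq (Assign 33 (Cell th (Add (Reg 20) (Const 1))))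
  (Seq (Store 29 (Reg 33) (Const 1))
  (Seq (Cond (Cell 28 (Reg 33))
         (Seq (Assign 30 (Minus (Cell 28 (Reg 33)) (Const 1)))
         (Seq (Assign 31 (Reg 33))
              (Cond (Eq (Reg 30) (Reg 32)) Skip emit)))
         (Seq drop_kept
         (Seq (Assign 31 (Cell 19 (Reg 28)))
         (Seq (Assign 30 (Minus (Cell 28 (Reg 31)) (Const 1)))
         (Seq (Assign 28 (Minus (Reg 28) (Const 1)))
         (Seq (Store 28 (Reg 31) (Const 0))
              emit))))))
       (Store 28 (Reg 33) (Add (Reg 32) (Const 1)))))).

(** At the end arrays 28 and 29 are nonzero only at heads of the goal tree, so clearing them there
    restores zeros for the next call in O(k). *)
Definition morph tt th :=
  Seq (For 20 (Reg 3)
        (Store 28 (Cell 19 (Add (Reg 20) (Const 1)))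
                  (Add (Cell 18 (Add (Reg 20) (Const 1))) (Const 1))))
  (Seq (Assign 28 (Reg 3))
  (Seq (For 20 (Reg 3) (morph_step tt th))
       (For 20 (Reg 3)
         (Seq (Store 28 (Cell th (Add (Reg 20) (Const 1))) (Const 0))
              (Store 29 (Cell th (Add (Reg 20) (Const 1))) (Const 0)))))).

Definition parents l (g : nat -> nat) :=
  (forall a, a \in l -> g a.2 = a.1.+1) /\ (forall v, v \notin heads l -> g v = 0).

Lemma exchange_mid p q a b (c : seq (nat * nat)) : perm_eq q (a :: c) -> a != b ->
  exchange (a, b) (p ++ q) (p ++ b :: c).
Proof.
move=> pq ab; exists (p ++ c); split=> //=.
  by rewrite (perm_trans (_ : perm_eq _ (p ++ a :: c))) ?perm_cat2l // -cat1s perm_catCA.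
by rewrite -cat1s perm_catCA.
Qed.

(** The current tree is never stored as a list. It consists of the first [i] goal arcs and, in their
    old order, those of the first [j] old arcs whose heads are not yet settled. *)
Definition morph_inv A k r l b l0 tr i s s' := exists j tr',
  let p := take i b in let q := [seq a <- take j l | a.2 \notin heads p] in
  [/\ [/\ frame [:: 8; 20; 28; 30; 31; 32; 33] [:: 0; 1; 2; 3; 28; 29] s s',
          j <= k & reg s' 28 = j],
      size q = k - i /\ grows [:: r] (p ++ q),
      [/\ emitted tr' s', recon A k l0 tr' (p ++ q) & size tr' <= size tr + i],
      (forall v, cells s' 29 v = (v \in heads p)) &
      parents (p ++ q) (cells s' 28)].

Lemma parents_exchange (g : nat -> nat) p q (a b : nat * nat) (c : seq (nat * nat)) :
  perm_eq q (a :: c) ->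
  uniq (heads (p ++ b :: c)) -> uniq (heads (p ++ q)) -> parents (p ++ q) g ->
  parents (p ++ b :: c) (fun v => if v == b.2 then b.1.+1 else if v == a.2 then 0 else g v).
Proof.
move=> pq ub uq [g1 g0].
have pqE : perm_eq (p ++ q) (a :: p ++ c).
  by rewrite (perm_trans (_ : perm_eq _ (p ++ a :: c))) ?perm_cat2l // -cat1s perm_catCA.
have pbE : perm_eq (p ++ b :: c) (b :: p ++ c) by rewrite -cat1s perm_catCA.
have ua := uq; rewrite (perm_uniq (perm_map _ pqE)) /= in ua.
have ub' := ub; rewrite (perm_uniq (perm_map _ pbE)) /= in ub'.
case/andP: ua ub' => na _ /andP[nb _]; split=> [d|v].
  rewrite (perm_mem pbE) inE => /orP[/eqP->|dc]; first by rewrite eqxx.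
  have dh : d.2 \in heads (p ++ c) by exact: map_f.
  case: eqP => [E|_]; first by rewrite -E dh in nb.
  case: eqP => [E|_]; first by rewrite -E dh in na.
  by apply: g1; rewrite (perm_mem pqE) inE dc orbT.
rewrite (perm_mem (perm_map _ pbE)) /= inE negb_or => /andP[/negbTE-> vn].
case: eqP => // /eqP va; apply: g0.
by rewrite (perm_mem (perm_map _ pqE)) /= inE negb_or va.
Qed.

Lemma parents_ext (g g' : nat -> nat) l : g =1 g' -> parents l g -> parents l g'.
Proof. by move=> E [H1 H2]; split=> [a al|v vl]; rewrite -E ?H1 ?H2. Qed.

(** Twice the pointer in register 28 is a potential: a single step may pass many arcs in
    [drop_kept], but this is paid by the drop of the pointer. *)
Lemma wp_morph_step W tt th A k r l b l0 tr i s s1 :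
  tt \notin [:: 0; 1; 2; 3; 28; 29] -> th \notin [:: 0; 1; 2; 3; 28; 29] ->
  k.+2 < W -> size tr + k < W -> (forall a, a \in A -> a.1.+1 < W) ->
  tree_at 18 19 r l s -> tree_at tt th r b s ->
  rtree A k r l -> rtree A k r b -> i < k ->
  morph_inv A k r l b l0 tr i s s1 -> reg s1 20 = i ->
  wp W (morph_step tt th) s1 (fun t s2 =>
    [/\ reg s2 20 = i, morph_inv A k r l b l0 tr i.+1 s (set_reg s2 20 i.+1) &
        t + 2 * reg s2 28 <= 30 + 2 * reg s1 28]).
Proof.
move=> tt6 th6 kW trW AW tl tb [gl szl lA] [gb szb bA] ik.
move=> [j [tr' [[F jk r28] [szq gpq] [em rc tri] Inc Par]]] r20.
have [p pdef] : exists p, take i b = p by exists (take i b).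
rewrite pdef in szq gpq rc Inc Par *.
have [q qdef] : exists q, [seq a <- take j l | a.2 \notin heads p] = q by eexists.
rewrite qdef in szq gpq rc Par *.
have [d ddef] : exists d, nth arc0 b i = d by eexists.
have tS : take i.+1 b = rcons p d by rewrite -pdef -ddef -take_nth // szb.
have gS := grows_take i.+1 gb; rewrite tS grows_rcons in gS.
case/and3P: gS => gp d1 d2.
have rev_root v : (v \in heads p ++ [:: r]) = (v \in r :: heads p).
  by rewrite mem_cat !inE orbC.
rewrite !rev_root in d1 d2.
have gpq' := grows_exchange gpq d1 d2.
have dA : d \in A by apply: bA; rewrite -ddef mem_nth ?szb.
have q0 : q != [::] by rewrite -size_eq0 szq subn_eq0 -ltnNge.
have uq : uniq (heads q).
  by have := grows_uniq gpq; rewrite /heads map_cat cat_uniq => /and3P[].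
have pq := evict_rest d.2 q0 uq.
have [dE1 dE2] : cells s1 tt i.+1 = d.1 /\ cells s1 th i.+1 = d.2.
  by rewrite !F.2 // -ddef -(tb.2 i) ?szb.
have hS v : (v \in heads (rcons p d)) = (v \in d.2 :: heads p).
  by rewrite /heads map_rcons mem_rcons.
have szr : size (rest d.2 q) = k - i.+1 by rewrite subnS -szq (perm_size pq).
(* Shared by three outcomes: the goal arc is already present, it replaces another arc into the same
   vertex, or it replaces the last unsettled arc. *)
have close j' tr'' s2 :
    frame [:: 8; 20; 28; 30; 31; 32; 33] [:: 0; 1; 2; 3; 28; 29] s s2 ->
    j' <= j -> reg s2 28 = j' ->
    [seq a <- take j' l | a.2 \notin d.2 :: heads p] = rest d.2 q ->
    emitted tr'' s2 -> recon A k l0 tr'' (p ++ d :: rest d.2 q) ->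
    size tr'' <= (size tr').+1 ->
    (forall v, cells s2 29 v = (v \in d.2 :: heads p)) ->
    (forall v, cells s2 28 v = if v == d.2 then d.1.+1
       else if v == (evict d.2 q).2 then 0 else cells s1 28 v) ->
    morph_inv A k r l b l0 tr i.+1 s (set_reg s2 20 i.+1).
  move=> F2 jj r28' qE em' rc' tri' Inc' Par'; exists j', tr''.
  rewrite tS /= cat_rcons.
  have -> : [seq a <- take j' l | a.2 \notin heads (rcons p d)] = rest d.2 q.
    by rewrite -qE; apply: eq_filter => a; rewrite hS.
  split; [split=> //; [frm|nlia]|by []|split=> //; nlia| |].
    by move=> v; rewrite Inc' hS.
  apply: parents_ext (parents_exchange pq (grows_uniq gpq') (grows_uniq gpq) Par) => v.
  by rewrite Par'.
have t6 a : a \notin [:: 0; 1; 2; 3; 28; 29] -> a == 29 = false.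
  by rewrite !inE !negb_or => /and5P[_ _ _ _ /andP[_ /negbTE]].
have iW : i.+1 < W by nlia.
do 2!(apply: wp_seq; apply: wp_assign); apply: wp_seq; apply: wp_store => /=.
rewrite !r20 !eval_incr // dE1 dE2 modn_small; last nlia.
set s2 := set_mem _ _ _ _.
have Inc2 v : cells s2 29 v = (v \in d.2 :: heads p).
  by rewrite /= inE; case: eqP => //= _; exact: Inc.
have F2 : frame [:: 8; 20; 28; 30; 31; 32; 33] [:: 0; 1; 2; 3; 28; 29] s s2 by frm.
have em2 : emitted tr' s2 by [].
have trW' : (size tr').+1 < W by nlia.
have subS : {subset p ++ d :: rest d.2 q <= A}.
  move=> a; rewrite mem_cat inE -pdef => /or3P[/mem_take/bA//|/eqP->//|].
  by move=> /mem_take; rewrite mem_filter -qdef => /andP[_]; rewrite mem_filter => /andP[_ /mem_take/lA].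
have szS : size (p ++ d :: rest d.2 q) = k.
  by rewrite size_cat /= szr -pdef size_take szb ik; nlia.
have rS : rtree A k r (p ++ d :: rest d.2 q) by split.
apply: wp_seq; apply: wp_cond => /=.
have [/mapP[a aq ad]|nd] := boolP (d.2 \in heads q).
  have evE : evict d.2 q = a by rewrite ad evict_head.
  have PE : cells s1 28 d.2 = a.1.+1 by rewrite ad Par.1 // mem_cat aq orbT.
  rewrite PE /=; wps; rewrite /= PE modn_small ?subn1 /=; last nlia.
  have qE : [seq a <- take j l | a.2 \notin d.2 :: heads p] = rest d.2 q.
    rewrite ad rest_head // -ad -qdef -filter_predI; apply: eq_filter => c /=.
    by rewrite inE negb_or.
  apply: wp_cond => /=; rewrite eqb0 negbK.
  set s3 := set_reg _ _ _.
  have F3 : frame [:: 8; 20; 28; 30; 31; 32; 33] [:: 0; 1; 2; 3; 28; 29] s s3 by frm.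
  case: eqP => [E|/eqP nE] /=.
    have ea : a = d by rewrite [a]surjective_pairing [d]surjective_pairing E ad.
    apply: wp_skip; apply: wp_store => /=; rewrite eval_incr; last exact: AW.
    split=> //; last by nlia.
    apply: (close j tr') => //.
    - frm.
    - by apply: recon_perm rc _; rewrite perm_cat2l; move: pq; rewrite evE ea.
    - by move=> v /=; case: eqP => //= /eqP nv; rewrite evE -ad (negbTE nv).
  apply: wp_mono (wp_emit (s := s3) (tr := tr') em2 trW') _ => t s4 [tb4 F4 em4].
  apply: wp_store => /=; rewrite !F4.1 //= eval_incr; last exact: AW.
  split=> //; last by nlia.
  apply: (close j (rcons tr' (a, d))) => //.
  - apply: frame_mem => //; apply: frame_trans F3 _; exact: frame_sub F4 _ _.
  - by rewrite /= F4.1.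
  - by move: em4; rewrite /s3 /= -surjective_pairing (_ : (a.1, d.2) = a) // ad -surjective_pairing.
  - apply: recon_rcons rc _ rS; apply: exchange_mid; rewrite -?evE //.
    by rewrite evE; apply: contra nE => /eqP->.
  - by rewrite size_rcons.
  - by move=> v /=; rewrite F4.2 //; exact: Inc2.
  - move=> v /=; rewrite evE -ad; case: eqP => //= _.
    by rewrite F4.2.
have PE : cells s1 28 d.2 = 0.
  apply: Par.2; rewrite /heads map_cat mem_cat negb_or nd.
  by move: d2; rewrite inE negb_or => /andP[_ ->].
rewrite PE /=.
have qE jj : [seq a <- take jj l | a.2 \notin d.2 :: heads p] =
    [seq c <- [seq a <- take jj l | a.2 \notin heads p] | c.2 != d.2].
  by rewrite -filter_predI; apply: eq_filter => c /=; rewrite inE negb_or.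
have qEj : [seq a <- take j l | a.2 \notin d.2 :: heads p] = q.
  by rewrite qE qdef filter_headNC.
apply: wp_seq; apply: wp_mono (@wp_drop_kept W r l (fun v => v \in d.2 :: heads p) j s2 _ _ _ _ _ _) _ => //.
- nlia.
- by rewrite szl.
- by apply: tree_at_frame F2 _ _ tl.
- by rewrite qEj.
move=> t3 s3 [j' [tb3 /andP[j0 jj] F3 r28']]; rewrite qEj.
set z := nth arc0 l j'.-1; set q' := filter _ _ => qrc.
have nd' : d.2 \notin heads (rcons q' z) by rewrite -qrc.
have evE : evict d.2 q = z by rewrite qrc evict_last.
have rE : rest d.2 q = q' by rewrite qrc rest_last.
have zq : z \in q by rewrite qrc mem_rcons mem_head.
have F23 : frame [:: 8; 20; 28; 30; 31; 32; 33] [:: 0; 1; 2; 3; 28; 29] s s3.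
  apply: frame_trans F2 _; exact: frame_sub F3 _ _.
have zE : cells s3 19 j' = z.2.
  by rewrite F23.2 // -{1}(prednK j0) /z -(tl.2) //; rewrite szl; nlia.
have PzE : cells s3 28 z.2 = z.1.+1.
  by rewrite F3.2 //= Par.1 // mem_cat zq orbT.
do 3!(apply: wp_seq; apply: wp_assign); apply: wp_seq; apply: wp_store.
rewrite /= r28' zE PzE mod0n modn_small ?subn1 /=; last nlia.
set s4 := set_mem _ _ _ _.
have em4 : emitted tr' s4.
  by apply: emitted_frame (_ : frame [:: 28; 30; 31] [:: 28] s2 s4) _ _ em2 => //;
    [do 4 (try (apply: frame_reg; first by []); try (apply: frame_mem; first by [])); exact: frame_sub F3 _ _|case=> [|[|[|[|]]]]].
apply: wp_mono (wp_emit em4 trW') _ => t5 s5 [tb5 F5 em5].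
apply: wp_store => /=; rewrite !F5.1 //= !F3.1 //= eval_incr; last exact: AW.
split=> //; last by rewrite r28; nlia.
apply: (close j'.-1 (rcons tr' (z, d))) => //.
- apply: frame_mem => //; apply: (@frame_trans _ _ _ s4); first by frm.
  exact: frame_sub F5 _ _.
- nlia.
- by rewrite /= F5.1.
- by move: em5; rewrite /s4 /= !F3.1 //= -!surjective_pairing.
- apply: recon_rcons rc _ rS; apply: exchange_mid; rewrite -?evE //.
  by rewrite evE; apply: contra nd => /eqP<-; apply: map_f.
- by rewrite size_rcons.
- by move=> v /=; rewrite F5.2 //= F3.2 //.
- move=> v /=; rewrite evE; case: eqP => //= _.
  by rewrite F5.2 //= F3.2.
Qed.

Lemma parents_rcons l a (g : nat -> nat) : a.2 \notin heads l -> parents l g ->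
  parents (rcons l a) (fun v => if v == a.2 then a.1.+1 else g v).
Proof.
move=> na [g1 g0]; split=> [b|v]; rewrite ?/heads ?map_rcons mem_rcons inE.
  case/orP => [/eqP->|bl]; first by rewrite eqxx.
  by case: eqP => [E|_]; [case/negP: na; rewrite -E map_f|exact: g1].
by rewrite negb_or => /andP[/negbTE-> /g0].
Qed.

Lemma wp_morph W tt th A k r l b l0 tr s :
  tt \notin [:: 0; 1; 2; 3; 28; 29] -> th \notin [:: 0; 1; 2; 3; 28; 29] ->
  k.+2 < W -> size tr + k < W -> (forall a, a \in A -> a.1.+1 < W) ->
  reg s 3 = k ->
  tree_at 18 19 r l s -> tree_at tt th r b s ->
  rtree A k r l -> rtree A k r b ->
  (forall v, cells s 28 v = 0) -> (forall v, cells s 29 v = 0) ->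
  emitted tr s -> recon A k l0 tr l ->
  wp W (morph tt th) s (fun t s' => exists tr',
    [/\ t <= 50 * k + 20,
        frame [:: 8; 20; 28; 30; 31; 32; 33] [:: 0; 1; 2; 3; 28; 29] s s',
        (forall v, cells s' 28 v = 0) /\ (forall v, cells s' 29 v = 0),
        emitted tr' s' /\ size tr' <= size tr + k & recon A k l0 tr' b]).
Proof.
move=> tt6 th6 kW trW AW r3 tl tb rl rb P0 I0 em rc.
have [gl szl lA] := rl; have [gb szb bA] := rb.
have ubl := grows_uniq gl; have ubb := grows_uniq gb.
apply: wp_seq; apply: (@wp_forc W 1 (fun i s' => frame [:: 20] [:: 28] s s' /\
   parents (take i l) (cells s' 28)) k); first nlia.
- by move=> j s1 [F _] /=; rewrite F.1.
- split; first frm.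
  by rewrite take0; split=> // v _ /=.
- move=> i s1 ik [F Par] r20; apply: wp_store => /=.
  have il : i < size l by rewrite szl.
  have aA : nth arc0 l i \in A by apply: lA; rewrite mem_nth.
  have [E1 E2] : cells s1 18 i.+1 = (nth arc0 l i).1 /\ cells s1 19 i.+1 = (nth arc0 l i).2.
    by rewrite !F.2 // -tl.2.
  rewrite r20 (@eval_incr W i); last nlia.
  rewrite E1 eval_incr; last exact: AW.
  split=> //; split; first frm.
  rewrite (take_nth arc0) // E2.
  have nl : (nth arc0 l i).2 \notin heads (take i l).
    have := ubl; rewrite -{1}(cat_take_drop i l) (drop_nth arc0 il) /heads map_cat cat_uniq /=.
    by rewrite negb_or => /and3P[_ /andP[+ _] _].
  by have := parents_rcons nl Par.
move=> t1 s1 tb1 [F1 Par1]; rewrite -szl take_size in Par1.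
apply: wp_seq; apply: wp_assign => /=.
set s2 := set_reg _ _ _.
have F2 : frame [:: 20; 28] [:: 28] s s2.
  by apply: frame_reg => //; exact: frame_sub F1 _ _.
have k2 : reg s2 28 = k by rewrite /= F1.1.
have tl2 : tree_at 18 19 r l s2 by apply: tree_at_frame F2 _ _ tl.
have tb2 : tree_at tt th r b s2.
  by apply: tree_at_frame F2 _ _ tb; [move: tt6|move: th6]; rewrite !inE !negb_or => /and5P[_ _ _ _ /andP[]].
have em2 : emitted tr s2 by apply: emitted_frame F2 _ _ em => // -[|[|[|[|]]]].
have q0E : [seq a <- l | a.2 \notin [::]] = l by apply/all_filterP/allP.
apply: wp_seq; apply: (@wp_for W (fun i t s' => morph_inv A k r l b l0 tr i s2 s' /\
    t + 2 * reg s' 28 <= 30 * i + 2 * k) k); first nlia.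
- move=> j t s3 [[jj [tr' [[F _ _] _ _ _ _]]] _] /=; by rewrite F.1 //= F1.1.
- split; last by rewrite /= F1.1 //; nlia.
  exists k, tr; rewrite take0 /= -szl take_size q0E; split=> //.
  + by split=> //; [frm|rewrite F1.1 // r3].
  + by split; [rewrite subn0|].
  + by split=> //; [rewrite szl | rewrite addn0].
  + by move=> v; rewrite F1.2 // I0.
- move=> i t s3 ik [Inv tb3] r20.
  apply: wp_mono (wp_morph_step tt6 th6 kW trW AW tl2 tb2 rl rb ik Inv r20) _.
  by move=> t' s4 [r20' Inv' tb4]; split=> //; split=> //=; nlia.
move=> t3 s3 [[j [tr' [[F3 _ _] [szq _] [em3 rc3 tr3] Inc3 Par3]]] tb3] r20.
have bE : take k b = b by rewrite -szb take_size.
(* With all [k] goal arcs taken, counting leaves no old arc. *)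
rewrite bE subnn in szq Inc3 Par3 rc3.
rewrite (size0nil szq) cats0 in Par3 rc3.
have F23 : frame [:: 8; 20; 28; 30; 31; 32; 33] [:: 0; 1; 2; 3; 28; 29] s s3.
  by apply: frame_trans F3; exact: frame_sub F2 _ _.
apply: (@wp_forc W 2 (fun i s' => frame [:: 20] [:: 28; 29] s3 s' /\
   forall v, v \notin heads (drop i b) -> cells s' 28 v = 0 /\ cells s' 29 v = 0) k); first nlia.
- by move=> jj s4 [F _] /=; rewrite F.1 // F23.1.
- split; first frm.
  by rewrite drop0 => v vb; split; [exact: Par3.2|rewrite /= Inc3 (negbTE vb)].
- move=> i s4 ik [F H] r20'; wps => /=.
  have ib : i < size b by rewrite szb.
  have th28 : (th == 28) = false.
    by move: th6; rewrite !inE !negb_or => /and5P[_ _ _ _ /andP[/negbTE]].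
  have th29 : (th == 29) = false.
    by move: th6; rewrite !inE !negb_or => /and5P[_ _ _ _ /andP[_ /negbTE]].
  have E : cells s4 th i.+1 = (nth arc0 b i).2.
    by rewrite F.2 ?F23.2 // ?inE ?th28 ?th29 // -tb.2.
  rewrite r20' !eval_incr ?th28 /=; last nlia.
  rewrite E mod0n; split=> //; split; first frm.
  move=> v vd; have [//|v_] := eqVneq v (nth arc0 b i).2; apply: H.
  by rewrite (drop_nth arc0) //= inE negb_or v_.
move=> t4 s4 tb4 [F4 H4]; exists tr'; split.
- nlia.
- by apply: frame_trans F23 _; exact: frame_sub F4 _ _.
- by split=> v; case: (H4 v) => //; rewrite drop_oversize // szb.
- by split=> //; apply: emitted_frame F4 _ _ em3 => // -[|[|[|[|]]]].
- exact: rc3.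
Qed.

(** * Labelling the component of the goal root *)

Definition upd (f : nat -> nat) w x v := if v == w then x else f v.

(** Labels number the vertices in order of discovery. They are thus at most [n], and their strict
    decrease along [nxt] bounds the length of the walk. *)
Definition labelling n A k g c (lab nxt dir : nat -> nat) :=
  [/\ c = count (fun v => lab v != 0) (iota 0 n), lab g != 0,
      (forall v, lab v <= c), (forall v, lab v != 0 -> v < n) &
      forall w, lab w != 0 -> w != g ->
        [/\ lab (nxt w) != 0, lab (nxt w) < lab w &
            if dir w != 0 then linked A k (nxt w) w else linked A k w (nxt w)]].

Lemma count_upd (js : seq nat) (P Q : pred nat) w : uniq js -> w \in js -> ~~ P w ->
  (forall v, Q v = (v == w) || P v) -> count Q js = (count P js).+1.
Proof.
move=> uj wj nP QE; have := count_predUI (pred1 w) P js.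
have -> : count (predU (pred1 w) P) js = count Q js.
  by apply: eq_count => v; rewrite /= QE.
have -> : count (predI (pred1 w) P) js = 0.
  apply/eqP; rewrite -leqn0 leqNgt -has_count.
  by apply/hasP => -[v _ /= /andP[/eqP-> Pw]]; rewrite Pw in nP.
by rewrite addn0 count_uniq_mem // wj => ->.
Qed.

Lemma labelling_mark n A k g c lab nxt dir w p dc : labelling n A k g c lab nxt dir ->
  lab w = 0 -> lab p != 0 -> w < n ->
  (if dc != 0 then linked A k p w else linked A k w p) ->
  labelling n A k g c.+1 (upd lab w c.+1) (upd nxt w p) (upd dir w dc).
Proof.
move=> [cE gl le lt H] w0 p0 wn lk; split.
- rewrite (@count_upd _ (fun v => lab v != 0) _ w) -?cE //.
  + exact: iota_uniq.
  + by rewrite mem_iota.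
  + by rewrite w0.
  + by move=> v; rewrite /upd; case: (v == w).
- by rewrite /upd; case: (g == w).
- by move=> v; rewrite /upd; case: (v == w) => //; apply: leqW.
- by move=> v; rewrite /upd; have [->|_ /lt] := eqVneq v w.
- move=> v; rewrite /upd; have [-> _ _|_ v0 vg] := eqVneq v w.
    have [E|_] := eqVneq p w; first by rewrite E w0 in p0.
    by split=> //; rewrite ltnS.
  have [n0 nl d] := H _ v0 vg; have -> : (nxt v == w) = false.
    by apply/eqP => E; rewrite E w0 in n0.
  by split.
Qed.

Lemma labelling_ext n A k g c lab nxt dir lab' nxt' dir' :
  lab =1 lab' -> nxt =1 nxt' -> dir =1 dir' ->
  labelling n A k g c lab nxt dir -> labelling n A k g c lab' nxt' dir'.
Proof.
move=> E1 E2 E3 [cE gl le lt H]; split.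
- by rewrite cE; apply: eq_count => v; rewrite E1.
- by rewrite -E1.
- by move=> v; rewrite -E1.
- by move=> v; rewrite -E1; exact: lt.
- by move=> w; rewrite -!E2 -!E3 -!E1; exact: H.
Qed.

Definition mark w p dc :=
  Seq (Assign 34 (Add (Reg 34) (Const 1)))
  (Seq (Store 25 (Reg w) (Reg 34))
  (Seq (Store 26 (Reg w) (Reg p))
  (Seq (Store 27 (Reg w) (Const dc))
       (Assign 35 (Const 1))))).

Definition label_step :=
  Seq (Assign 36 (Cell 0 (Reg 20)))
  (Seq (Assign 37 (Cell 1 (Reg 20)))
  (Cond (Eq (Cell 24 (Reg 36)) (Reg 3))
    (Cond (Lt (Reg 3) (Add (Cell 24 (Reg 37)) (Const 2)))
      (Cond (Cell 25 (Reg 36))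
        (Cond (Cell 25 (Reg 37)) Skip (mark 37 36 1))
        (Cond (Cell 25 (Reg 37)) (mark 36 37 0) Skip))
      Skip)
    Skip)).

(** Sweeping over all arcs until nothing changes uses each edge in both directions without lists of
    incoming arcs. Every sweep but the last adds a label, so at most [n] sweeps occur. *)
Definition label :=
  Seq (Store 25 (Reg 7) (Const 1))
  (Seq (Assign 34 (Const 1))
  (Seq (Assign 35 (Const 1))
  (While (Reg 35)
    (Seq (Assign 35 (Const 0))
         (For 20 (Reg 1) label_step))))).

Definition sized n A k (sz : nat -> nat) := forall v, v < n ->
  [/\ sz v <= k, sz v = k <-> feasible A k v & k < sz v + 2 <-> feasible A k.-1 v].

Definition label_inv n A k g s s' :=
  [/\ frame [:: 20; 34; 35; 36; 37] [:: 25; 26; 27] s s', reg s' 35 <= 1 &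
      labelling n A k g (reg s' 34) (cells s' 25) (cells s' 26) (cells s' 27)].

Definition closed_upto A k i s' := forall j, j < i ->
  linked A k (nth arc0 A j).1 (nth arc0 A j).2 ->
  (cells s' 25 (nth arc0 A j).1 != 0) = (cells s' 25 (nth arc0 A j).2 != 0).

Lemma wp_mark W n A k g s s1 w p dc : n + 2 < W -> dc < W ->
  w \in [:: 36; 37] -> p \in [:: 36; 37] -> w != p ->
  label_inv n A k g s s1 -> cells s1 25 (reg s1 w) = 0 -> cells s1 25 (reg s1 p) != 0 ->
  reg s1 w < n ->
  (if dc != 0 then linked A k (reg s1 p) (reg s1 w) else linked A k (reg s1 w) (reg s1 p)) ->
  wp W (mark w p dc) s1 (fun t s2 => [/\ t = 5, label_inv n A k g s s2,
    reg s2 20 = reg s1 20, reg s2 35 = 1 & reg s2 34 = (reg s1 34).+1]).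
Proof.
move=> nW dW w2 p2 wp [F _ L] w0 p0 wn lk.
have [w34 p34] : w == 34 = false /\ p == 34 = false.
  by split; [move: w2|move: p2]; rewrite !inE => /orP[]/eqP->.
have c_n : reg s1 34 <= n.
  by case: L => -> _ _ _ _; rewrite (leq_trans (count_size _ _)) // size_iota.
wps; rewrite /= w34 p34 eval_incr ?modn_small; try lia.
split=> //; split=> //=; first frm.
by apply: labelling_ext (labelling_mark L w0 p0 wn lk).
Qed.

Lemma wp_label_step W n A k g s i c0 s1 :
  n + 2 < W -> k + 2 < W -> stored 0 1 A s -> reg s 3 = k ->
  (forall a, a \in A -> (a.1 < n) && (a.2 < n)) -> sized n A k (cells s 24) ->
  i < size A -> label_inv n A k g s s1 -> (reg s1 35 = 0 -> closed_upto A k i s1) ->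
  c0 + reg s1 35 <= reg s1 34 -> reg s1 20 = i ->
  wp W label_step s1 (fun t s2 =>
    [/\ t <= 12, reg s2 20 = i, label_inv n A k g s (set_reg s2 20 i.+1),
        (reg s2 35 = 0 -> closed_upto A k i.+1 s2) & c0 + reg s2 35 <= reg s2 34]).
Proof.
move=> nW kW st r3 An sz iA [F ch L] cl c01 r20.
set a := nth arc0 A i.
have aA : a \in A by apply: mem_nth.
have [a1n a2n] := andP (An _ aA).
have [E1 E2] : cells s1 0 i = a.1 /\ cells s1 1 i = a.2.
  by rewrite !F.2 // /a -st.
have [sz1 f1 _] := sz _ a1n; have [sz2 _ f2] := sz _ a2n.
do 2!(apply: wp_seq; apply: wp_assign); rewrite /= r20 E1 E2.
set s2 := set_reg _ _ _.
have I2 : label_inv n A k g s s2 by split=> //; frm.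
have I3 s3 : label_inv n A k g s s3 -> label_inv n A k g s (set_reg s3 20 i.+1).
  by move=> [F3 ? ?]; split=> //; frm.
have same : (linked A k a.1 a.2 -> (cells s1 25 a.1 != 0) = (cells s1 25 a.2 != 0)) ->
   reg s2 35 = 0 -> closed_upto A k i.+1 s2.
  move=> H r35 j; rewrite ltnS leq_eqVlt => /orP[/eqP->|ji]; first exact: H.
  exact: cl.
have lkP : linked A k a.1 a.2 <-> cells s 24 a.1 = k /\ k < cells s 24 a.2 + 2.
  split=> [[_ /f1 ? /f2]//|[/f1 ? /f2 ?]]; split=> //.
  by rewrite -surjective_pairing.
apply: wp_cond => /=; rewrite F.2 // eqb0 negbK F.1 // r3.
case: eqP => [e1|ne1] /=; last first.
  apply: wp_skip; split=> //; first exact: I3.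
  by apply: same => /lkP[].
apply: wp_cond => /=; rewrite F.2 // !F.1 // r3 eqb0 negbK.
have szW : cells s 24 a.2 + 2 < W by apply: leq_ltn_trans kW; rewrite leq_add2r.
rewrite (@modn_small 2) ?modn_small //; last lia.
case: ltnP => [e2|ne2] /=; last first.
  apply: wp_skip; split=> //; first exact: I3.
  by apply: same => /lkP[_]; lia.
have lk : linked A k a.1 a.2 by apply/lkP.
apply: wp_cond => /=; case: eqP => /= [l1|/eqP l1].
  apply: wp_cond => /=; case: eqP => /= [l2|/eqP l2].
    by apply: wp_skip; split=> //; [exact: I3|apply: same; rewrite l1 l2].
  apply: wp_mono (@wp_mark W n A k g s s2 36 37 0 nW _ _ _ _ I2 l1 l2 a1n lk) _ => //; first lia.
  move=> t s3 [-> I r20' r35 r34]; split=> //; [by rewrite r20'|exact: I3|by rewrite r35|].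
  by rewrite r35 r34 /=; lia.
apply: wp_cond => /=; case: eqP => /= [l2|/eqP l2]; last first.
  by apply: wp_skip; split=> //; [exact: I3|apply: same; rewrite l1 l2].
apply: wp_mono (@wp_mark W n A k g s s2 37 36 1 nW _ _ _ _ I2 l2 l1 a2n lk) _ => //; first lia.
move=> t s3 [-> I r20' r35 r34]; split=> //; [by rewrite r20'|exact: I3|by rewrite r35|].
by rewrite r35 r34 /=; lia.
Qed.

Lemma wp_label W n A k g s :
  n + 2 < W -> k + 2 < W -> (size A).+1 < W -> stored 0 1 A s ->
  reg s 1 = size A -> reg s 3 = k -> reg s 7 = g -> g < n ->
  (forall a, a \in A -> (a.1 < n) && (a.2 < n)) -> sized n A k (cells s 24) ->
  (forall v, cells s 25 v = 0) ->
  wp W label s (fun t s' =>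
    [/\ t <= (14 * size A + 7) * n + 7,
        frame [:: 20; 34; 35; 36; 37] [:: 25; 26; 27] s s',
        exists2 c, c <= n & labelling n A k g c (cells s' 25) (cells s' 26) (cells s' 27) &
        forall x v, linked A k x v -> (cells s' 25 x != 0) = (cells s' 25 v != 0)]).
Proof.
move=> nW kW mW st r1 r3 r7 gn An sz L0.
apply: wp_seq; apply: wp_store; do 2!(apply: wp_seq; apply: wp_assign).
rewrite /= r7 !modn_small; try lia.
set s1 := set_reg _ _ _; set B := 14 * size A + 7.
(* Every sweep is charged to a label: that of [g] pays for the initial one, and a raised flag stands
   for a sweep that is earned but not yet run. In the measure a new label outweighs the flag. *)
apply: (@wp_while W (fun t s' => [/\ label_inv n A k g s s',
   (reg s' 35 = 0 -> closed_upto A k (size A) s') & t + B * reg s' 35 <= B * reg s' 34])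
   (fun s' => 2 * (n - reg s' 34) + reg s' 35)).
- split=> //; split=> //=; first frm.
  split=> //=.
  + rewrite (@count_upd _ pred0 _ g) ?count_pred0 ?iota_uniq ?mem_iota // => v.
    by rewrite L0; case: (v == g).
  + by rewrite eqxx.
  + by move=> v; rewrite L0; case: (v == g).
  + by move=> v; have [->|_] := eqVneq v g; rewrite ?L0.
  + by move=> v; have [|_] := eqVneq v g; rewrite ?L0.
- move=> t s2 [[F ch L] cl tb] /= r35.
  apply: wp_seq; apply: wp_assign => /=; rewrite mod0n.
  set s3 := set_reg _ _ _.
  have r35' : reg s2 35 = 1 by lia.
  apply: (@wp_forc W 12 (fun i s' => [/\ label_inv n A k g s s',
    (reg s' 35 = 0 -> closed_upto A k i s') & reg s2 34 + reg s' 35 <= reg s' 34]) (size A)); first lia.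
  + by move=> j s' [[F' _ _] _ _] /=; rewrite F'.1.
  + by split=> //=; [split=> //; frm|rewrite addn0].
  + move=> i s' iA [I c1 c2] r20.
    apply: wp_mono (wp_label_step nW kW st r3 An sz iA I c1 c2 r20) _.
    by move=> t' s4 [tb' r20' I' c1' c2'].
  + move=> t' s' tb' [[F' ch' L'] c1' c2'].
    have c_n : reg s' 34 <= n.
      by case: L' => -> _ _ _ _; rewrite (leq_trans (count_size _ _)) // size_iota.
    split; last by rewrite r35'; lia.
    by split=> //; rewrite r35' in tb; rewrite /B in tb *; nia.
- move=> t s2 [[F ch L] cl tb] /= r35.
  have c_n : reg s2 34 <= n.
    by case: L => -> _ _ _ _; rewrite (leq_trans (count_size _ _)) // size_iota.
  split=> //.
  + by rewrite /B in tb *; nia.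
  + by exists (reg s2 34).
  + move=> x v lk; have [xv _ _] := lk.
    have := cl r35 (index (x, v) A); rewrite index_mem nth_index //; exact.
Qed.

(** * Walking along the labels *)

Definition hop mt mh ra rb rc rd :=
  Seq (morph mt mh)
  (Seq (Assign 30 (Reg ra)) (Seq (Assign 31 (Reg rb))
  (Seq (Assign 32 (Reg rc)) (Seq (Assign 33 (Reg rd)) emit)))).

Lemma wp_hop W mt mh ra rb rc rd A k r l b r' b' l0 tr s :
  all [in [:: 10; 25; 26; 27; 39]] [:: ra; rb; rc; rd] ->
  mt \notin [:: 0; 1; 2; 3; 28; 29] -> mh \notin [:: 0; 1; 2; 3; 28; 29] ->
  k.+2 < W -> size tr + k.+1 < W -> (forall a, a \in A -> a.1.+1 < W) ->
  reg s 3 = k ->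
  tree_at 18 19 r l s -> tree_at mt mh r b s ->
  rtree A k r l -> rtree A k r b -> rtree A k r' b' ->
  exchange ((reg s ra, reg s rb), (reg s rc, reg s rd)) b b' ->
  (forall v, cells s 28 v = 0) -> (forall v, cells s 29 v = 0) ->
  emitted tr s -> recon A k l0 tr l ->
  wp W (hop mt mh ra rb rc rd) s (fun t s' => exists tr',
    [/\ t <= 50 * k + 29,
        frame [:: 8; 20; 28; 30; 31; 32; 33] [:: 0; 1; 2; 3; 28; 29] s s',
        (forall v, cells s' 28 v = 0) /\ (forall v, cells s' 29 v = 0),
        emitted tr' s' /\ size tr' <= size tr + k.+1 & recon A k l0 tr' b']).
Proof.
move=> regs mt6 mh6 kW trW AW r3 tl tb rl rb' rb'' ex P0 I0 em rc'.
have reg_out x : x \in [:: 10; 25; 26; 27; 39] ->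
    [/\ x != 30, x != 31, x != 32 & x \notin [:: 8; 20; 28; 30; 31; 32; 33]].
  by rewrite !inE => /or4P[|||/orP[]] /eqP->.
case/and5P: regs => /reg_out[a0 a1 a2 ao] /reg_out[b0 b1 b2 bo].
move=> /reg_out[c0 c1 c2 co] /reg_out[d0 d1 d2 do_] _.
apply: wp_seq; apply: wp_mono (wp_morph mt6 mh6 kW _ AW r3 tl tb rl rb' P0 I0 em rc') _.
  by lia.
move=> t s1 [tr1 [tb1 F1 [P1 I1] [em1 sz1] rc1]].
do 4!(apply: wp_seq; apply: wp_assign); rewrite /=.
rewrite (negbTE b0) (negbTE c0) (negbTE c1) (negbTE d0) (negbTE d1) (negbTE d2).
set s2 := set_reg _ _ _.
have em2 : emitted tr1 s2 by [].
apply: wp_mono (wp_emit em2 _) _; first by lia.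
move=> t2 s3 [tb3 F3 em3].
exists (rcons tr1 ((reg s ra, reg s rb), (reg s rc, reg s rd))).
split.
- lia.
- apply: frame_trans F1 _; apply: (@frame_trans _ _ _ s2); first by frm.
  exact: frame_sub F3 _ _.
- by split=> v; rewrite F3.2 //=.
- split; last by rewrite size_rcons; lia.
  by move: em3; rewrite /s2 /= !F1.1.
- exact: recon_rcons rc1 ex rb''.
Qed.

(** The arc goes from [x] in register 25 to [h] in register 10, whose search tree is in 16 and 17.
    The root moves up from [h] to [x], or down from [x] to [h], or, if [h] carries only [k - 1]
    arcs, past [h] to the vertex in register 39 through which [h] was labelled. In this last case
    the new tree differs from the one in 22 and 23 only at the root, hence the two stores. *)
Definition walk_move :=
  Cond (Reg 38)
    (Seq (hop 16 17 26 27 25 10)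
    (Seq (Seq (copy 22 18) (copy 23 19)) (Assign 6 (Reg 25))))
    (Cond (Eq (Reg 11) (Reg 3))
      (Seq (hop 22 23 25 10 26 27)
      (Seq (Seq (copy 16 18) (copy 17 19)) (Assign 6 (Reg 10))))
      (Seq (Assign 39 (Cell 26 (Reg 10)))
      (Seq (hop 22 23 25 10 39 10)
      (Seq (Store 22 (Const 1) (Reg 39))
      (Seq (Store 23 (Const 0) (Reg 39))
      (Seq (Seq (copy 22 18) (copy 23 19)) (Assign 6 (Reg 39)))))))).

Definition walk_step :=
  Seq (Assign 24 (Cell 26 (Reg 6)))
  (Seq (Assign 38 (Cell 27 (Reg 6)))
  (Seq (Cond (Reg 38)
         (Seq (Assign 10 (Reg 6)) (Assign 25 (Reg 24)))
         (Seq (Assign 10 (Reg 24)) (Assign 25 (Reg 6))))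
  (Seq (bfs 12)
  (Seq link walk_move)))).

Definition walk := While (Eq (Eq (Reg 6) (Reg 7)) (Const 0)) walk_step.

Definition walk_regs :=
  [:: 6; 8; 10; 11; 12; 13; 14; 15; 16; 20; 24; 25; 26; 27; 28; 29; 30; 31; 32; 33; 38; 39].
Definition walk_arrays := [:: 0; 1; 2; 3; 15; 16; 17; 18; 19; 22; 23; 28; 29].

(** The last inequality reserves [k + 1] exchanges for each unit of the label of the current
    root. *)
Definition walking A k l0 s0 N s := exists l tr,
  [/\ frame walk_regs walk_arrays s0 s,
      tree_at 18 19 (reg s 6) l s /\ rtree A k (reg s 6) l,
      [/\ forall v, cells s 15 v = 0, forall v, cells s 28 v = 0 &
          forall v, cells s 29 v = 0],
      emitted tr s /\ recon A k l0 tr l &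
      cells s0 25 (reg s 6) != 0 /\ size tr + cells s0 25 (reg s 6) * k.+1 <= N].

Lemma adj_frame rs ms A i f s s' : frame rs ms s s' ->
  10 \notin ms -> 11 \notin ms -> f \notin ms -> adj A i f s -> adj A i f s'.
Proof.
move=> F m10 m11 mf [L H]; split=> [u|j ji]; last by rewrite F.2 ?H.
rewrite F.2 //; apply: linked_list_eq (L u) => j _; by rewrite F.2.
Qed.

Lemma exchange_evict x h D : 0 < size D -> h \notin heads D -> uniq (heads D) ->
  exchange (evict x D, (x, h)) D ((x, h) :: rest x D).
Proof.
move=> k0 hD uD; have D0 : D != [::] by rewrite -size_eq0 -lt0n.
have p := evict_rest x D0 uD; exists (rest x D); split=> //=.
apply: contra hD => /eqP E; have : evict x D \in D by rewrite (perm_mem p) mem_head.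
by rewrite E => /(map_f snd).
Qed.

Lemma wp_walk_step W n A k g c l0 s0 N s :
  k.+2 < W -> N + k.+1 < W -> (forall a, a \in A -> a.1.+1 < W) -> 1 < k ->
  reg s0 2 = k.+1 -> reg s0 3 = k -> adj A (size A) 12 s0 ->
  labelling n A k g c (cells s0 25) (cells s0 26) (cells s0 27) -> feasible A k g ->
  walking A k l0 s0 N s -> reg s 6 != g ->
  wp W walk_step s (fun t s' => [/\ t <= 20 * size A + 90 * k + 150,
    walking A k l0 s0 N s' & cells s0 25 (reg s' 6) < cells s0 25 (reg s 6)]).
Proof.
move=> kW NW AW k1 r2 r3 ad L fg [l [tr [F [tl rl] [M0 P0 I0] [em rc] [lr0 trN]]]] rg.
have [_ _ _ _ Lnxt] := L; have [nx0 nxlt lk] := Lnxt _ lr0 rg.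
have k0 : 0 < k by lia.
have [r rE] : exists r, reg s 6 = r by eexists.
rewrite rE in tl rl lr0 trN rg nx0 nxlt lk *.
have [v vE] : exists v, cells s0 26 r = v by eexists.
have [up upE] : exists up, (cells s0 27 r != 0) = up by eexists.
rewrite vE upE in nx0 nxlt lk.
have vE' : cells s 26 r = v by rewrite F.2.
have dE : cells s 27 r = cells s0 27 r by rewrite F.2.
have [h hE] : exists h, h = if up then r else v by eexists.
have [x xE] : exists x, x = if up then v else r by eexists.
have lkx : linked A k x h by rewrite xE hE; case: (up) lk.
have vr : v != r by apply/eqP => E; rewrite E ltnn in nxlt.
have xh : x != h by rewrite xE hE; case: (up); rewrite // eq_sym.
do 2!(apply: wp_seq; apply: wp_assign); apply: wp_seq; apply: wp_cond => /=.
rewrite rE vE' dE upE.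
set s1 := set_reg (set_reg s 24 v) 38 _.
pose s2 := set_reg (set_reg s1 10 h) 25 x.
(* The two orientations differ only in which end is called [h], so the rest is done once for
   both. *)
suff : wp W (Seq (bfs 12) (Seq link walk_move)) s2
    (fun t s' => [/\ t <= 20 * size A + 90 * k + 140,
       walking A k l0 s0 N s' & cells s0 25 (reg s' 6) < cells s0 25 r]).
  rewrite /s2 hE xE; case: (up) => H /=;
    do 2!(apply: wp_seq || apply: wp_assign); apply: wp_assign; rewrite /= ?rE;
    by apply: wp_mono H _ => t s' [tb ? ?]; split=> //; lia.
have F2 : frame walk_regs walk_arrays s0 s2 by frm.
have [r38 r6] : (reg s2 38 != 0) = up /\ reg s2 6 = r by [].
have [r10 r25] : reg s2 10 = h /\ reg s2 25 = x by [].
have ad2 : adj A (size A) 12 s2 by apply: adj_frame F2 _ _ _ ad.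
have tl2 : tree_at 18 19 r l s2 by [].
have em2 : emitted tr s2 by [].
have M2 : forall v, cells s2 15 v = 0 by [].
have P2 : forall v, cells s2 28 v = 0 by [].
have I2 : forall v, cells s2 29 v = 0 by [].
move: s2 F2 r38 r6 r10 r25 ad2 tl2 em2 M2 P2 I2.
clear s1; clear s F tl em M0 P0 I0 vE' dE rg rE => s F r38 r6 r10 r25 ad' tl em M0 P0 I0.
have r3' : reg s 3 = k by rewrite F.1.
apply: wp_seq; apply: wp_mono (wp_bfs _ kW r3' r10 ad' M0) _ => //.
move=> t1 s1 [D [tb1 F1 M1 [gD DA Dk maxD] [tD1 r11]]].
have [xhA fx fh] := lkx.
have szD : k.-1 <= size D.
  case: maxD => [->|cl]; first exact: leq_pred.
  exact: feasible_closed cl (mem_head _ _) fh.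
(* A search tree with fewer than [k] arcs is closed, so a feasible vertex inside it forces it to be
   full. *)
have szDf w : w \in h :: heads D -> feasible A k w -> size D = k.
  move=> wD fw; case: maxD => // cl; apply/eqP; rewrite eqn_leq Dk.
  exact: feasible_closed cl wD fw.
have uD := grows_uniq gD.
have hD : h \notin heads D by have := grows_uniq_root gD => /andP[].
have D0 : 0 < size D <= k by rewrite Dk andbT; lia.
have F01 : frame walk_regs walk_arrays s0 s1.
  by apply: frame_trans F _; exact: frame_sub F1 _ _.
have r3_1 : reg s1 3 = k by rewrite F01.1.
have r10_1 : reg s1 10 = h by rewrite F1.1.
have r25_1 : reg s1 25 = x by rewrite F1.1.
apply: wp_seq; apply: wp_mono (wp_link k0 kW r3_1 r10_1 r25_1 r11 D0 uD tD1) _.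
set E := (x, h) :: _.
move=> t2 s2 [tb2 F2 tE ev].
have F12 : frame walk_regs walk_arrays s s2.
  by apply: (@frame_trans _ _ _ s1); [exact: frame_sub F1 _ _|exact: frame_sub F2 _ _].
have F02 : frame walk_regs walk_arrays s0 s2 by apply: frame_trans F F12.
have Fsl : frame [:: 11; 12; 13; 14; 15; 16; 20; 26; 27; 29] [:: 15; 16; 17; 22; 23] s s2.
  by apply: (@frame_trans _ _ _ s1); [exact: frame_sub F1 _ _|exact: frame_sub F2 _ _].
have r3_2 : reg s2 3 = k by rewrite F02.1.
have r2_2 : reg s2 2 = k.+1 by rewrite F02.1.
have r38_2 : (reg s2 38 != 0) = up by rewrite Fsl.1.
have r11_2 : reg s2 11 = size D by rewrite F2.1.
have r10_2 : reg s2 10 = h by rewrite F2.1.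
have r25_2 : reg s2 25 = x by rewrite F2.1.
have tl_2 : tree_at 18 19 r l s2 by apply: tree_at_frame Fsl _ _ tl.
have tD_2 : tree_at 16 17 h D s2 by apply: tree_at_frame F2 _ _ tD1.
have em_2 : emitted tr s2 by apply: emitted_frame Fsl _ _ em => // -[|[|[|[|]]]].
have M_2 w : cells s2 15 w = 0 by rewrite F2.2.
have P_2 w : cells s2 28 w = 0 by rewrite Fsl.2.
have I_2 w : cells s2 29 w = 0 by rewrite Fsl.2.
have trW : size tr + k.+1 < W by lia.
have ER : size D = k -> E = (x, h) :: rest x D by move=> Dsz; rewrite /E /rest Dsz.
have tDk : size D = k -> rtree A k h D by move=> Dsz; split.
have tEk : size D = k -> rtree A k x E.
  by move=> Dsz; rewrite ER //; apply: rtree_link => //; exact: tDk.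
have kW2 : k.+1 < W by lia.
(* Common end of the three moves: the smaller label of the new root pays for the exchanges. *)
have finish r' l' tr' s3 s4 :
    frame walk_regs walk_arrays s0 s3 -> rtree A k r' l' ->
    (forall w, cells s3 15 w = 0) ->
    (forall w, cells s3 28 w = 0) /\ (forall w, cells s3 29 w = 0) ->
    emitted tr' s3 -> size tr' <= size tr + k.+1 -> recon A k l0 tr' l' ->
    cells s0 25 r' != 0 -> cells s0 25 r' < cells s0 25 r ->
    frame [:: 20] [:: 18; 19] s3 s4 -> tree_at 18 19 r' l' s4 ->
    walking A k l0 s0 N (set_reg s4 6 r') /\
    cells s0 25 (reg (set_reg s4 6 r') 6) < cells s0 25 r.
  move=> F3 rt M3 [P3 I3] em3 tr3 rc3 l3 lt3 F4 t4; split=> //.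
  exists l', tr'; split=> //=.
  - apply: frame_reg => //; apply: frame_trans F3 _; exact: frame_sub F4 _ _.
  - by split=> w /=; rewrite F4.2.
  - split=> //; have : emitted tr' s4.
      by apply: emitted_frame F4 _ _ em3 => // -[|[|[|[|]]]].
    by [].
  - split=> //; have : (cells s0 25 r').+1 * k.+1 <= cells s0 25 r * k.+1.
      by rewrite leq_mul2r lt3 orbT.
    by rewrite mulSn; lia.
apply: wp_cond; rewrite /= r38_2; case: (boolP up) => upT /=.
  have [hr xv] : h = r /\ x = v by rewrite hE xE upT.
  have Dsz : size D = k by apply: szDf (mem_head _ _) _; rewrite hr; exists l.
  have szE : size E = k by case: (tEk Dsz).
  rewrite -hr in tl_2 rl.
  apply: wp_seq.
  apply: wp_mono (wp_hop (r' := x) (b' := E) _ _ _ kW trW AW r3_2 tl_2 tD_2 rl (tDk Dsz) (tEk Dsz) _ P_2 I_2 em_2 rc) _ => //.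
    by rewrite ev r25_2 r10_2 ER //; apply: exchange_evict => //; rewrite Dsz.
  move=> t3 s3 [tr3 [tb3 F3 PI3 [em3 sz3] rc3]].
  apply: wp_seq; apply: wp_mono (@wp_copy_tree W 22 23 18 19 x E s3 _ _ _ _ _ _) _ => //.
  - by rewrite szE.
  - by rewrite F3.1 // szE.
  - by apply: tree_at_frame F3 _ _ tE.
  move=> t4 s4 [tb4 F4 t4E]; apply: wp_assign => /=.
  rewrite F4.1 // F3.1 // r25_2.
  have [] := finish x E tr3 s3 s4 _ (tEk Dsz) _ PI3 em3 sz3 rc3 _ _ F4 t4E.
  - by apply: frame_trans F02 _; exact: frame_sub F3 _ _.
  - by move=> w; rewrite F3.2.
  - by rewrite xv.
  - by rewrite xv.
  by move=> walk' lt'; split=> //; rewrite szE in tb4; lia.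
have [hv xr] : h = v /\ x = r by rewrite hE xE (negbTE upT).
rewrite -xr in tl_2 rl.
apply: wp_cond; rewrite /= r11_2 r3_2 eqb0 negbK; case: eqP => [Dsz|/eqP Dsz] /=.
  have szE : size E = k by case: (tEk Dsz).
  apply: wp_seq.
  apply: wp_mono (wp_hop (r' := h) (b' := D) _ _ _ kW trW AW r3_2 tl_2 tE rl (tEk Dsz) (tDk Dsz) _ P_2 I_2 em_2 rc) _ => //.
    rewrite ev r25_2 r10_2 ER //; apply: (@exchange_sym (evict x D, (x, h))).
    by apply: exchange_evict => //; rewrite Dsz.
  move=> t3 s3 [tr3 [tb3 F3 PI3 [em3 sz3] rc3]].
  apply: wp_seq; apply: wp_mono (@wp_copy_tree W 16 17 18 19 h D s3 _ _ _ _ _ _) _ => //.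
  - by rewrite Dsz.
  - by rewrite F3.1 // Dsz.
  - by apply: tree_at_frame F3 _ _ tD_2.
  move=> t4 s4 [tb4 F4 t4E]; apply: wp_assign => /=.
  rewrite F4.1 // F3.1 // r10_2.
  have [] := finish h D tr3 s3 s4 _ (tDk Dsz) _ PI3 em3 sz3 rc3 _ _ F4 t4E.
  - by apply: frame_trans F02 _; exact: frame_sub F3 _ _.
  - by move=> w; rewrite F3.2.
  - by rewrite hv.
  - by rewrite hv.
  by move=> walk' lt'; split=> //; rewrite Dsz in tb4; lia.
(* Now the search tree of [h] is closed with [k - 1] arcs. Nothing in it is feasible, so [x], [y]
   and [g] all lie outside. *)
have nf w : feasible A k w -> w \notin h :: heads D.
  by move=> fw; apply: contra Dsz => /szDf/(_ fw) ->.
have szDk : size D = k.-1 by lia.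
have hg : h != g by apply: contraNneq (nf g fg) => <-; rewrite mem_head.
have lh0 : cells s0 25 h != 0 by rewrite hv.
have [y0 ylt lky] := Lnxt _ lh0 hg.
have [y yE] : exists y, cells s0 26 h = y by eexists.
rewrite yE in y0 ylt lky.
have nfh : ~ feasible A k h by move=> /nf; rewrite mem_head.
(* [h] must have been labelled through an arc into it: the tail of a link is feasible. *)
have {lky} [yhA fy _] : linked A k y h by case: ifP lky => // _ [_ /nfh].
have link_tree w : (w, h) \in A -> feasible A k w -> rtree A k w ((w, h) :: D).
  move=> whA /nf wD; split.
  - have wh : w != h by apply: contraNneq wD => ->; rewrite mem_head.
    have wD' : w \notin heads D by move: wD; rewrite inE negb_or => /andP[].
    by have := grows_link (size D) gD wh; rewrite filter_headNC // take_size.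
  - by rewrite /= szDk prednK.
  - by move=> a; rewrite inE => /orP[/eqP->|/DA].
have ED : E = (x, h) :: D.
  rewrite /E filter_headNC ?take_oversize ?szDk //.
  by have := nf x fx; rewrite inE negb_or => /andP[].
have tEx : rtree A k x E by rewrite ED; exact: link_tree.
have tEy := link_tree y yhA fy.
apply: wp_seq; apply: wp_assign; rewrite /= r10_2 F02.2 // yE.
set s3 := set_reg s2 39 y.
apply: wp_seq.
apply: wp_mono (wp_hop (s := s3) (ra := 25) (rb := 10) (rc := 39) (rd := 10)
  (r' := y) (b' := (y, h) :: D) _ _ _ kW trW AW r3_2 tl_2 tE rl tEx tEy _ P_2 I_2 em_2 rc) _ => //.
  rewrite /= r25_2 r10_2 ED; exists D; split=> //=.
  (* Labels tell [x] and [y] apart: that of [y] is below that of [h], which is below that of [x]. *)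
  by apply/eqP => -[E']; move: ylt; rewrite -E' xr hv; lia.
move=> t3 s4 [tr3 [tb3 F3 PI3 [em3 sz3] rc3]].
do 2!(apply: wp_seq; apply: wp_store); rewrite /= mod0n modn_small; last lia.
rewrite !F3.1 //= ?eqxx.
set s5 := set_mem _ _ _ _.
have tE5 : tree_at 22 23 y ((y, h) :: D) s5.
  have [] : tree_at 22 23 x E s4 by apply: tree_at_frame F3 _ _ tE.
  rewrite ED => _ tE4; split=> // -[|i] iD.
    by have := tE4 0 isT => /= -[_ ->].
  by have := tE4 i.+1 iD.
have szy : size ((y, h) :: D) = k by rewrite /= szDk prednK.
apply: wp_seq; apply: wp_mono (@wp_copy_tree W 22 23 18 19 y _ s5 _ _ _ _ _ tE5) _ => //.
- by rewrite szy.
- by rewrite szy /= F3.1.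
move=> t5 s6 [tb5 F5 t5E]; apply: wp_assign => /=.
rewrite F5.1 //= F3.1 //=.
have em5 : emitted tr3 s5 by [].
have PI5 : (forall w, cells s5 28 w = 0) /\ (forall w, cells s5 29 w = 0) by [].
have [] := finish y _ tr3 s5 s6 _ tEy _ PI5 em5 sz3 rc3 _ _ F5 t5E.
- do 2!(apply: frame_mem => //); apply: (@frame_trans _ _ _ s3); first by frm.
  exact: frame_sub F3 _ _.
- by move=> w; rewrite /= F3.2 //=.
- by [].
- by apply: ltn_trans ylt _; rewrite hv.
by move=> walk' lt'; split=> //; rewrite szy in tb5; lia.
Qed.

Lemma wp_walk W n A k g c l0 s0 N s :
  k.+2 < W -> N + k.+1 < W -> (forall a, a \in A -> a.1.+1 < W) -> 1 < k ->
  reg s0 2 = k.+1 -> reg s0 3 = k -> reg s0 7 = g -> adj A (size A) 12 s0 ->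
  labelling n A k g c (cells s0 25) (cells s0 26) (cells s0 27) -> feasible A k g ->
  walking A k l0 s0 N s ->
  wp W walk s (fun t s' => [/\
    t <= (20 * size A + 90 * k + 151) * cells s0 25 (reg s 6) + 2,
    walking A k l0 s0 N s' & reg s' 6 = g]).
Proof.
move=> kW NW AW k1 r2 r3 r7 ad L fg Is; set B := 20 * _ + _ + _.
have guard s' : walking A k l0 s0 N s' ->
    eval W s' (Eq (Eq (Reg 6) (Reg 7)) (Const 0)) = (reg s' 6 != g).
  move=> [l [tr [F _ _ _ _]]] /=; rewrite (F.1 7) // r7 mod0n.
  by case: (reg s' 6 == g).
apply: (@wp_while W (fun t s' => walking A k l0 s0 N s' /\
   t + B * cells s0 25 (reg s' 6) <= B * cells s0 25 (reg s 6))
   (fun s' => cells s0 25 (reg s' 6))).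
- by [].
- move=> t s1 [I1 tb]; rewrite (guard _ I1); case: (boolP (_ != g)) => // rg _.
  apply: wp_mono (wp_walk_step kW NW AW k1 r2 r3 ad L fg I1 rg) _.
  move=> t' s2 [tb' I2 lt]; split=> //; split=> //.
  have : B * (cells s0 25 (reg s2 6)).+1 <= B * cells s0 25 (reg s1 6).
    by rewrite leq_mul2l lt orbT.
  by rewrite mulnS {1}/B; lia.
- move=> t s1 [I1 tb]; rewrite (guard _ I1); case: eqP => // rg _; split=> //.
  lia.
Qed.

(** * Which vertices can be roots *)

Definition sizes :=
  For 23 (Reg 0) (Seq (Assign 10 (Reg 23))
                 (Seq (bfs 12) (Store 24 (Reg 23) (Reg 11)))).

(** One bounded search settles both thresholds [k] and [k - 1], because a search that falls short of
    [k] is closed and hence maximal. *)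
Lemma search_tree_sized A k h D : search_tree A k h D ->
  [/\ size D <= k, size D = k <-> feasible A k h & k < size D + 2 <-> feasible A k.-1 h].
Proof.
move=> [g DA Dk mx]; have ub j : j <= k -> feasible A j h -> j <= size D.
  by case: mx => [->//|cl] _; apply: feasible_closed cl (mem_head _ _).
split=> //; split.
- by move=> Dsz; exists D.
- by move=> /(ub k (leqnn k)) kD; apply/eqP; rewrite eqn_leq Dk.
- move=> kD; apply: (@feasibleW _ _ (size D)); [lia|by exists D].
- by move=> /(ub _ (leq_pred k)); lia.
Qed.

Lemma wp_sizes W n A k s : n < W -> k.+2 < W -> reg s 0 = n -> reg s 3 = k ->
  adj A (size A) 12 s -> (forall v, cells s 15 v = 0) ->
  wp W sizes s (fun t s' => [/\ t <= (20 * size A + 20 * k + 34) * n + 3,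
    frame [:: 10; 11; 12; 13; 14; 15; 16; 23] [:: 15; 16; 17; 24] s s',
    forall v, cells s' 15 v = 0 & sized n A k (cells s' 24)]).
Proof.
move=> nW kW r0 r3 ad M0.
apply: (@wp_forc W (20 * size A + 20 * k + 32) (fun i s' => [/\
    frame [:: 10; 11; 12; 13; 14; 15; 16; 23] [:: 15; 16; 17; 24] s s',
    forall v, cells s' 15 v = 0 & sized i A k (cells s' 24)]) n) => //.
- by move=> j s' [F _ _] /=; rewrite F.1.
- by split=> //; frm.
- move=> i s1 iN [F M S] r23; apply: wp_seq; apply: wp_assign; rewrite /= r23.
  set s2 := set_reg _ _ _.
  have F2 : frame [:: 10; 11; 12; 13; 14; 15; 16; 23] [:: 15; 16; 17; 24] s s2 by frm.
  have r3_2 : reg s2 3 = k by rewrite F2.1.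
  have ad2 : adj A (size A) 12 s2 by apply: adj_frame F2 _ _ _ ad.
  apply: wp_seq; apply: wp_mono (@wp_bfs W 12 A k i s2 _ kW r3_2 _ ad2 _) _ => //.
  move=> t s3 [D [tb F3 M3 st [_ r11]]]; apply: wp_store; rewrite /= r11 F3.1 //= r23.
  split; [lia|by []|split].
  + apply: frame_reg => //; apply: frame_mem => //; apply: frame_trans F2 _.
    exact: frame_sub F3 _ _.
  + by move=> v /=.
  + move=> v; rewrite ltnS leq_eqVlt /=; case: eqP => [->|_] /=.
      by move=> _; exact: search_tree_sized.
    by move=> vi; rewrite F3.2 //=; exact: S.
- by move=> t s' tb [F M S]; split=> //; lia.
Qed.

(** * Reading the two trees *)

Definition find_root vs hs dst :=
  Seq (Assign 21 (Const 0)) (Seq (Assign 22 (Const 0))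
  (Seq (For 20 (Reg 2)
         (Seq (Assign 21 (Add (Reg 21) (Cell vs (Reg 20))))
              (Assign 22 (Add (Reg 22) (Cell hs (Reg 20))))))
       (Assign dst (Minus (Reg 21) (Reg 22))))).

Lemma sum_nth_leq (V : seq nat) n i : all (fun v => v < n) V ->
  \sum_(0 <= j < i) nth 0 V j <= i * n.
Proof.
move=> /allP Vn; elim: i => [|i IH]; first by rewrite big_geq.
rewrite big_nat_recr //= mulSn addnC; apply: leq_add => //.
have [iV|Vi] := ltnP i (size V); first by apply/ltnW/Vn/mem_nth.
by rewrite nth_default.
Qed.

(* The root is the difference between the sum of the vertices and the sum of
   the heads of the arcs. *)
Lemma wp_find_root W n k r V H vs hs dst s : (k.+1 * n) < W -> k.+1 < W ->
  perm_eq V (r :: H) -> size H = k -> all (fun v => v < n) V ->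
  (forall j, cells s vs j = nth 0 V j) -> (forall j, cells s hs j = nth 0 H j) ->
  reg s 2 = k.+1 ->
  wp W (find_root vs hs dst) s (fun t s' => [/\ t <= 4 * k + 15,
    frame [:: 20; 21; 22; dst] [::] s s' & reg s' dst = r]).
Proof.
move=> nW kW pV szH Vn VE HE r2.
have Hn : all (fun v => v < n) H.
  by apply/allP => v vH; apply: (allP Vn); rewrite (perm_mem pV) inE vH orbT.
do 2!(apply: wp_seq; apply: wp_assign); rewrite /= mod0n; apply: wp_seq.
set s1 := set_reg _ _ _.
apply: (@wp_forc W 2 (fun i s' => [/\ frame [:: 20; 21; 22] [::] s s',
   reg s' 21 = \sum_(0 <= j < i) nth 0 V j & reg s' 22 = \sum_(0 <= j < i) nth 0 H j]) k.+1) => //.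
- by move=> j s' [F _ _] /=; rewrite F.1.
- by split; [frm|rewrite big_geq|rewrite big_geq].
- move=> i s' ik [F E1 E2] r20; wps; rewrite /= r20 !F.2 // VE HE E1 E2.
  (* Partial sums are at most [k.+1 * n], so no addition wraps around. *)
  have bound U : all (fun v => v < n) U -> \sum_(0 <= j < i) nth 0 U j + nth 0 U i < W.
    move=> Un; have := sum_nth_leq i.+1 Un; rewrite big_nat_recr //= => /leq_ltn_trans; apply.
    by apply: leq_ltn_trans nW; rewrite leq_mul2r ik orbT.
  rewrite !modn_small ?bound //; split=> //; split=> /=; first frm.
    by rewrite big_nat_recr.
  by rewrite big_nat_recr.
- move=> t s' tb [F E1 E2]; apply: wp_assign; rewrite /= E1 E2.
  have -> : \sum_(0 <= j < k.+1) nth 0 V j - \sum_(0 <= j < k.+1) nth 0 H j = r.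
    have szV : size V = k.+1 by rewrite (perm_size pV) /= szH.
    rewrite -{1}szV -(big_nth 0 predT id) (perm_big _ pV) big_cons /=.
    by rewrite big_nat_recr //= nth_default ?szH // addn0 -szH -(big_nth 0 predT id) addnK.
  split; [lia| |by rewrite eqxx].
  apply: frame_reg; first by rewrite !inE eqxx !orbT.
  by apply: frame_sub F _ _.
Qed.

(** The input gives the tree arcs in arbitrary order; searching inside the tree itself lists them
    top-down. The search follows immediately because the next [build] overwrites arrays 10 and
    11. *)
Definition load f ts hs rr bt bh :=
  Seq (build f ts hs (Reg 3)) (Seq (Assign 10 (Reg rr))
  (Seq (bfs f) (Seq (copy 16 bt) (copy 17 bh)))).

Lemma wp_load W f ts hs rr bt bh At k r s :
  f \in [:: 13; 14] -> ts < 8 -> hs < 8 -> rr \in [:: 6; 7] ->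
  [&& bt \in [:: 18; 20], bh \in [:: 19; 21] & bt != bh] ->
  k.+2 < W -> size At = k -> reg s 2 = k.+1 -> reg s 3 = k -> reg s rr = r ->
  stored ts hs At s -> (forall j, cells s f j = 0) -> (forall j, cells s 15 j = 0) ->
  (forall l, search_tree At k r l -> size l = k) ->
  wp W (load f ts hs rr bt bh) s (fun t s' => exists l,
    [/\ t <= 51 * k + 46,
        frame [:: 10; 11; 12; 13; 14; 15; 16; 20] [:: 10; 11; f; 15; 16; 17; bt; bh] s s',
        search_tree At k r l, tree_at bt bh r l s' & forall j, cells s' 15 j = 0]).
Proof.
move=> f2 ts8 hs8 rr2 /and3P[bt2 bh2 bb] kW szA r2 r3 rrr st f0 M0 full.
have f3 : f \in [:: 12; 13; 14] by move: f2; rewrite !inE => /orP[]->; rewrite ?orbT.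
have f15 : (15 == f) = false by move: f2; rewrite !inE => /orP[]/eqP->.
have rr20 : (rr == 20) = false by move: rr2; rewrite !inE => /orP[]/eqP->.
apply: wp_seq; apply: wp_mono (@wp_build W f ts hs 3 At s f3 ts8 hs8 _ _ _ st f0) _ => //.
- by rewrite szA; lia.
- by rewrite r3 szA.
move=> t1 s1 [tb1 F1 ad1]; apply: wp_seq; apply: wp_assign => /=.
rewrite F1.1 ?inE ?rr20 // rrr; set s2 := set_reg _ _ _.
pose ms := [:: 10; 11; f; 15; 16; 17; bt; bh].
have F2 : frame [:: 10; 11; 12; 13; 14; 15; 16; 20] ms s s2.
  apply: frame_reg => //; apply: frame_sub F1 _ _ => //.
  by rewrite /= /ms !inE !eqxx !orbT.
have M2 j : cells s2 15 j = 0 by rewrite /= F1.2 // !inE f15.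
have r3_2 : reg s2 3 = k by rewrite F2.1.
apply: wp_seq; apply: wp_mono (@wp_bfs W f At k r s2 f3 kW r3_2 _ ad1 M2) _ => //.
move=> t3 s3 [l [tb3 F3 M3 stl [tl _]]].
have szl := full _ stl.
have F3' : frame [:: 10; 11; 12; 13; 14; 15; 16; 20] ms s s3.
  apply: frame_trans F2 _; apply: frame_sub F3 _ _ => //.
  by rewrite /= /ms !inE !eqxx !orbT.
have [n1 n2] : 16 \notin [:: bt; bh] /\ 17 \notin [:: bt; bh].
  by move: bt2 bh2; rewrite !inE => /orP[]/eqP-> /orP[]/eqP->.
apply: wp_mono (wp_copy_tree n1 n2 bb _ _ tl) _; rewrite ?szl; [lia|by rewrite F3'.1|].
move=> t4 s4 [tb4 F4 t4l]; exists l; split=> //.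
- by rewrite szA in tb1 tb3; lia.
- apply: frame_trans F3' _; apply: frame_sub F4 _ _ => //.
  by rewrite /= /ms !inE !eqxx !orbT.
- move=> j; rewrite F4.2 //.
  by move: bt2 bh2; rewrite !inE => /orP[]/eqP-> /orP[]/eqP->.
Qed.

(** * Trees with at least two arcs *)

Definition solve_large :=
  Seq (find_root 2 4 6) (Seq (find_root 5 7 7)
  (Seq (load 13 3 4 6 18 19) (Seq (load 14 6 7 7 20 21)
  (Seq (build 12 0 1 (Reg 1)) (Seq sizes (Seq label
  (Cond (Cell 25 (Reg 6))
    (Seq walk (Seq (morph 20 21) (Seq (Assign 1 (Reg 8)) (Assign 0 (Const 1)))))
    (Assign 0 (Const 0))))))))).

Definition reported tr s := forall i, i < size tr ->
  ((cells s 0 i, cells s 1 i), (cells s 2 i, cells s 3 i)) = nth (arc0, arc0) tr i.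

Definition tree_input k r (At : seq (nat * nat)) (V : seq nat) n :=
  [/\ size At = k, perm_eq V (r :: heads At), all (fun v => v < n) V &
      forall l, search_tree At k r l -> size l = k /\ perm_eq l At].

(** [P] hides the array of labels behind its invariance. The factor of [n] in the time collects
    [sizes], [label] and [walk]: 54 = 20 + 14 + 20 and 110 = 20 + 90. *)
Lemma wp_solve_large W n A k As Ag Vs Vg rs rg s :
  1 < k -> k.+2 < W -> n + 2 < W -> k.+1 * n < W -> (size A).+1 < W ->
  n * k.+1 + k.+1 < W ->
  [/\ reg s 0 = n, reg s 1 = size A, reg s 2 = k.+1, reg s 3 = k & reg s 8 = 0] ->
  stored 0 1 A s -> stored 3 4 As s -> stored 6 7 Ag s ->
  (forall j, cells s 2 j = nth 0 Vs j) -> (forall j, cells s 5 j = nth 0 Vg j) ->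
  (forall j, cells s 4 j = nth 0 (heads As) j) ->
  (forall j, cells s 7 j = nth 0 (heads Ag) j) ->
  (forall a j, 7 < a -> cells s a j = 0) ->
  tree_input k rs As Vs n -> tree_input k rg Ag Vg n ->
  (forall a, a \in A -> (a.1 < n) && (a.2 < n)) ->
  {subset As <= A} -> {subset Ag <= A} ->
  wp W solve_large s (fun t s' => exists P : nat -> Prop,
    [/\ t <= 160 * k + 5 * size A + (54 * size A + 110 * k + 200) * n + 170,
        forall x v, linked A k x v -> (P x <-> P v), P rg,
        reg s' 0 != 0 <-> P rs &
        reg s' 0 != 0 -> exists ls lg tr,
          [/\ perm_eq ls As, perm_eq lg Ag, recon A k ls tr lg,
              size tr <= n * k.+1 + k & reg s' 1 = size tr /\ reported tr s']]).
Proof.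
move=> k1 kW nW knW mW NW [r0 r1 r2 r3 r8] st sts stg E2 E5 E4 E7 Z.
move=> [szs pVs Vsn fulls] [szg pVg Vgn fullg] An subs subg.
have shs : size (heads As) = k by rewrite size_map.
have shg : size (heads Ag) = k by rewrite size_map.
have AW a : a \in A -> a.1.+1 < W by move=> /An/andP[]; lia.
have kW1 : k.+1 < W by lia.
apply: wp_seq.
apply: wp_mono (@wp_find_root W n k rs Vs _ 2 4 6 s knW kW1 pVs shs Vsn E2 E4 r2) _.
move=> t1 s1 [tb1 F1 r6_1].
have E5' j : cells s1 5 j = nth 0 Vg j by rewrite F1.2.
have E7' j : cells s1 7 j = nth 0 (heads Ag) j by rewrite F1.2.
have r2_1 : reg s1 2 = k.+1 by rewrite F1.1.
apply: wp_seq.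
apply: wp_mono (@wp_find_root W n k rg Vg _ 5 7 7 s1 knW kW1 pVg shg Vgn E5' E7' r2_1) _.
move=> t2 s2 [tb2 F2 r7_2].
have F02 : frame [:: 6; 7; 20; 21; 22] [::] s s2.
  by apply: (@frame_trans _ _ _ s1); [exact: frame_sub F1 _ _|exact: frame_sub F2 _ _].
have r6_2 : reg s2 6 = rs by rewrite F2.1.
have sts_2 : stored 3 4 As s2 by move=> j jA; rewrite !F02.2 // sts.
apply: wp_seq.
apply: wp_mono (@wp_load W 13 3 4 6 18 19 As k rs s2 _ _ _ _ _ kW szs _ _ r6_2 sts_2 _ _ _) _ => //;
  try by [rewrite F02.1|move=> j; rewrite F02.2 // Z|move=> l /fulls[]].
move=> t3 s3 [ls [tb3 F3 sls tls M3]].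
have F03 : frame [:: 6; 7; 10; 11; 12; 13; 14; 15; 16; 20; 21; 22]
    [:: 10; 11; 13; 15; 16; 17; 18; 19] s s3.
  by apply: (@frame_trans _ _ _ s2); [exact: frame_sub F02 _ _|exact: frame_sub F3 _ _].
have r7_3 : reg s3 7 = rg by rewrite F3.1.
have stg_3 : stored 6 7 Ag s3 by move=> j jA; rewrite !F03.2 // stg.
apply: wp_seq.
apply: wp_mono (@wp_load W 14 6 7 7 20 21 Ag k rg s3 _ _ _ _ _ kW szg _ _ r7_3 stg_3 _ M3 _) _ => //;
  try by [rewrite F03.1|move=> j; rewrite F03.2 // Z|move=> l /fullg[]].
move=> t4 s4 [lg [tb4 F4 slg tlg M4]].
have F04 : frame [:: 6; 7; 10; 11; 12; 13; 14; 15; 16; 20; 21; 22]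
    [:: 10; 11; 13; 14; 15; 16; 17; 18; 19; 20; 21] s s4.
  by apply: (@frame_trans _ _ _ s3); [exact: frame_sub F03 _ _|exact: frame_sub F4 _ _].
have tls_4 : tree_at 18 19 rs ls s4 by apply: tree_at_frame F4 _ _ tls.
have st_4 : stored 0 1 A s4 by move=> j jA; rewrite !F04.2 // st.
apply: wp_seq; apply: wp_mono (@wp_build W 12 0 1 1 A s4 _ _ _ _ mW _ st_4 _) _ => //;
  try by [rewrite F04.1|move=> j; rewrite F04.2 // Z].
move=> t5 s5 [tb5 F5 ad5].
have F05 : frame [:: 6; 7; 10; 11; 12; 13; 14; 15; 16; 20; 21; 22]
    [:: 10; 11; 12; 13; 14; 15; 16; 17; 18; 19; 20; 21] s s5.
  by apply: (@frame_trans _ _ _ s4); [exact: frame_sub F04 _ _|exact: frame_sub F5 _ _].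
have [r0_5 r3_5] : reg s5 0 = n /\ reg s5 3 = k by rewrite !F05.1.
have M5 j : cells s5 15 j = 0 by rewrite F5.2.
have nW' : n < W by lia.
apply: wp_seq; apply: wp_mono (wp_sizes nW' kW r0_5 r3_5 ad5 M5) _.
move=> t6 s6 [tb6 F6 M6 sz6].
have F06 : frame [:: 6; 7; 10; 11; 12; 13; 14; 15; 16; 20; 21; 22; 23]
    [:: 10; 11; 12; 13; 14; 15; 16; 17; 18; 19; 20; 21; 24] s s6.
  by apply: (@frame_trans _ _ _ s5); [exact: frame_sub F05 _ _|exact: frame_sub F6 _ _].
have st_6 : stored 0 1 A s6 by move=> j jA; rewrite !F06.2 // st.
have [r1_6 r3_6] : reg s6 1 = size A /\ reg s6 3 = k by rewrite !F06.1.
have r7_6 : reg s6 7 = rg by rewrite F6.1 // F5.1 // F4.1.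
have rgn : rg < n by apply: (allP Vgn); rewrite (perm_mem pVg) mem_head.
have kW' : k + 2 < W by rewrite addn2.
have L6 v : cells s6 25 v = 0 by rewrite F06.2 // Z.
apply: wp_seq; apply: wp_mono (wp_label nW kW' mW st_6 r1_6 r3_6 r7_6 rgn An sz6 L6) _.
move=> t7 s7 [tb7 F7 [c cn L7] cl7].
have F07 : frame [:: 6; 7; 10; 11; 12; 13; 14; 15; 16; 20; 21; 22; 23; 34; 35; 36; 37]
    [:: 10; 11; 12; 13; 14; 15; 16; 17; 18; 19; 20; 21; 24; 25; 26; 27] s s7.
  by apply: (@frame_trans _ _ _ s6); [exact: frame_sub F06 _ _|exact: frame_sub F7 _ _].
have F47 : frame [:: 10; 11; 12; 13; 14; 15; 16; 20; 23; 34; 35; 36; 37]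
    [:: 10; 11; 12; 15; 16; 17; 24; 25; 26; 27] s4 s7.
  apply: (@frame_trans _ _ _ s5); first exact: frame_sub F5 _ _.
  by apply: (@frame_trans _ _ _ s6); [exact: frame_sub F6 _ _|exact: frame_sub F7 _ _].
have tls_7 : tree_at 18 19 rs ls s7 by apply: tree_at_frame F47 _ _ tls_4.
have tlg_7 : tree_at 20 21 rg lg s7 by apply: tree_at_frame F47 _ _ tlg.
have ad7 : adj A (size A) 12 s7.
  apply: adj_frame F7 _ _ _ _ => //; exact: adj_frame F6 _ _ _ ad5.
have r6_7 : reg s7 6 = rs by rewrite F47.1 // F4.1 // F3.1.
have r7_7 : reg s7 7 = rg by rewrite F7.1.
have [r2_7 r3_7] : reg s7 2 = k.+1 /\ reg s7 3 = k by rewrite !F07.1.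
have [szls pls] := fulls _ sls; have [szlg plg] := fullg _ slg.
have rts : rtree A k rs ls by case: sls => g1 g2 _ _; split=> // a /g2/subs.
have rtg : rtree A k rg lg by case: slg => g1 g2 _ _; split=> // a /g2/subg.
have Lg : cells s7 25 rg != 0 by case: L7.
apply: wp_cond; rewrite /= r6_7.
case: (boolP (cells s7 25 rs != 0)) => Ls; last first.
  apply: wp_assign; exists (fun v => cells s7 25 v != 0); rewrite /= mod0n.
  split=> //; first by nlia.
    by move=> x v /cl7->.
  by rewrite (negbTE Ls).
have Lsn : cells s7 25 rs <= n by case: L7 => _ _ /(_ rs) le _ _; apply: leq_trans cn.
have walk7 : walking A k ls s7 (n * k.+1) s7.
  exists ls, [::]; rewrite r6_7; split=> //.
  - by split=> // v; [rewrite F7.2|rewrite F07.2 // Z|rewrite F07.2 // Z].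
  - by split=> //=; split=> //; rewrite F07.1.
  - have le : cells s7 25 rs * k.+1 <= n * k.+1 by rewrite leq_mul2r Lsn orbT.
    by split=> //; exact: le.
have frg : feasible A k rg by exists lg.
apply: wp_seq.
apply: wp_mono (wp_walk kW NW AW k1 r2_7 r3_7 r7_7 ad7 L7 frg walk7) _.
move=> t8 s8 [tb8 [l [tr [F8 [tl8 rl8] [M8 P8 I8] [em8 rc8] [_ tr8]]]] r6_8].
rewrite r6_8 in tl8 rl8.
have tlg_8 : tree_at 20 21 rg lg s8 by apply: tree_at_frame F8 _ _ tlg_7.
have r3_8 : reg s8 3 = k by rewrite F8.1.
have tr8' : size tr <= n * k.+1 by apply: leq_trans tr8; exact: leq_addr.
have trW : size tr + k < W by nlia.
apply: wp_seq; apply: wp_mono (wp_morph _ _ kW trW AW r3_8 tl8 tlg_8 rl8 rtg P8 I8 em8 rc8) _ => //.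
move=> t9 s9 [tr9 [tb9 F9 _ [[em9 rep9] sz9] rc9]].
apply: wp_seq; do 2!apply: wp_assign; rewrite /= modn_small; last by nlia.
exists (fun v => cells s7 25 v != 0); split=> //.
- have : (20 * size A + 90 * k + 151) * cells s7 25 rs <= (20 * size A + 90 * k + 151) * n.
    by rewrite leq_mul2l Lsn orbT.
  move: tb8; rewrite r6_7; move: (_ * cells s7 25 rs) => y ? ?; nlia.
- by move=> x v /cl7->.
- by exists ls, lg, tr9; split=> //; nlia.
Qed.

(** * The algorithm *)

(** The product is a conjunction and the comparison with 0 a negation, so the length is 0 or 1.
    Array 3 is both input and output and is therefore overwritten last. *)
Definition solve_arc :=
  Seq (Assign 1 (Eq (Mul (Eq (Cell 3 (Const 0)) (Cell 6 (Const 0)))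
                         (Eq (Cell 4 (Const 0)) (Cell 7 (Const 0)))) (Const 0)))
  (Seq (Store 0 (Const 0) (Cell 3 (Const 0)))
  (Seq (Store 1 (Const 0) (Cell 4 (Const 0)))
  (Seq (Store 2 (Const 0) (Cell 6 (Const 0)))
  (Seq (Store 3 (Const 0) (Cell 7 (Const 0)))
       (Assign 0 (Const 1)))))).

Definition solve :=
  Cond (Eq (Reg 3) (Const 0))
    (Seq (Assign 1 (Const 0))
         (Assign 0 (Eq (Cell 2 (Const 0)) (Cell 5 (Const 0)))))
    (Cond (Eq (Reg 3) (Const 1)) solve_arc solve_large).

(** * From the machine back to digraphs *)

Section Correctness.
Variables (n : nat) (G Ts Tg : digraph 'I_n).
Implicit Types (T : digraph 'I_n) (L : seq ('I_n * 'I_n)) (Vl : seq 'I_n).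

Lemma nth_code_arc L i : nth arc0 [seq code_arc a | a <- L] i = (tail_code L i, head_code L i).
Proof.
rewrite /tail_code /head_code /of_seq.
by elim: L i => [|a L IH] [|i] //=.
Qed.

Lemma listed_tree T r L Vl : rooted_tree T r -> listing Vl (vset T) ->
  listing L (arcs T) ->
  perm_eq Vl (r :: heads L) /\ size Vl = #|arcs T|.+1.
Proof.
move=> rT lV lL; have [l [g E p]] := rooted_tree_growing rT.
have pL : perm_eq l L by rewrite (perm_trans p) // perm_sym.
have pV : perm_eq Vl (r :: heads l).
  apply: uniq_perm; [by rewrite (perm_uniq lV) enum_uniq|exact: grows_uniq_root g|].
  by move=> v; rewrite (perm_mem lV) mem_enum E.
split; first by rewrite (perm_trans pV) // perm_cons perm_map.
by rewrite (perm_size pV) /= size_map (perm_size p) -cardE.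
Qed.

Lemma listed_input k T r L Vl : rooted_tree T r -> listing Vl (vset T) ->
  listing L (arcs T) -> #|arcs T| = k ->
  tree_input k (val r) [seq code_arc a | a <- L] [seq val v | v <- Vl] n.
Proof.
move=> rT lV lL kT; have [pV szV] := listed_tree rT lV lL.
have szL : size [seq code_arc a | a <- L] = k by rewrite size_map (perm_size lL) -cardE.
have uL : uniq [seq code_arc a | a <- L].
  by rewrite (map_inj_uniq (@code_arc_inj n)) (perm_uniq lL) enum_uniq.
split=> //.
- by rewrite heads_code -map_cons perm_map.
- by apply/allP => _ /mapP[v _ ->]; exact: ltn_ord.
- move=> l [g sub lk mx]; have ul := grows_uniq_arcs g.
  suff pl : perm_eq l [seq code_arc a | a <- L] by rewrite (perm_size pl).
  case: mx => [szl|cl].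
    by apply: uniq_perm => // a; apply: (uniq_min_size ul sub _).2; rewrite szL szl.
  have E : [seq code_arc a | a <- L] =i [seq code_arc a | a <- enum (arcs T)].
    exact: perm_mem (perm_map _ lL).
  have := codes_tree_growing rT g.
  rewrite /codes_tree => /(_ _ _)/perm_trans; apply; last by rewrite perm_map // perm_sym.
    by move=> a /sub; rewrite E.
  by move=> a; rewrite -E; exact: cl.
Qed.

Lemma reconf_no_arcs : #|arcs Ts| = 0 -> reconfigurable G Ts Tg -> Ts = Tg.
Proof.
move=> ks [[|ell] [T [T0 Tl Td Te]]]; first by rewrite -T0.
have [+ _] := Te 0 isT; rewrite T0; move/eqP: ks; rewrite cards_eq0 => /eqP->.
by rewrite set0D cards0.
Qed.

Lemma reconf_refl : directed_tree_in G Ts -> Ts = Tg ->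
  reconf_seq G Ts Tg 0 (fun=> Ts).
Proof. by move=> ds E; split. Qed.

End Correctness.

Theorem theorem1 :
  exists (p : cmd) (c d : nat),
  forall (n : nat) (G Ts Tg : digraph 'I_n)
         (A : seq ('I_n * 'I_n))
         (Vs : seq 'I_n) (As : seq ('I_n * 'I_n))
         (Vg : seq 'I_n) (Ag : seq ('I_n * 'I_n)),
    vset G = [set: 'I_n] ->
    directed_tree_in G Ts ->
    directed_tree_in G Tg ->
    #|arcs Ts| = #|arcs Tg| ->
    listing A (arcs G) ->
    listing Vs (vset Ts) -> listing As (arcs Ts) ->
    listing Vg (vset Tg) -> listing Ag (arcs Tg) ->
    exists (t : nat) (s : state),
      [/\ exec ((#|vset G| + #|arcs G| + 2) ^ d) p
            (input_state A Vs As Vg Ag) t s,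
          t <= c * (#|vset G| * #|arcs G| + 1),
          accepts s <-> reconfigurable G Ts Tg &
          reconfigurable G Ts Tg ->
          exists (ell : nat) (T : nat -> digraph 'I_n),
            [/\ reconf_seq G Ts Tg ell T,
                ell <= c * #|vset G| ^ 2 &
                outputs s ell T]].
Proof.
(* The cube leaves room in a word for sums of vertices and numbers of exchanges, which are at most
   quadratic; 1000 absorbs the constants of all phases. *)
exists solve, 1000, 3 => n G Ts Tg A Vs As Vg Ag GV ds dg ksg lA lVs lAs lVg lAg.
rewrite GV cardsT card_ord.
have mE : size A = #|arcs G| by rewrite (perm_size lA) -cardE.
set m := #|arcs G| in mE *; set W := (n + m + 2) ^ 3.
suff [t [s [ex [? ? ?]]]] : wp W solve (input_state A Vs As Vg Ag) (fun t s =>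
    [/\ t <= 1000 * (n * m + 1), accepts s <-> reconfigurable G Ts Tg &
      reconfigurable G Ts Tg -> exists ell T,
        [/\ reconf_seq G Ts Tg ell T, ell <= 1000 * n ^ 2 & outputs s ell T]]).
  by exists t, s; split.
have [[rs rTs] [_ _ sTs]] := ds; have [[rg rTg] [_ _ sTg]] := dg.
have [k kE] : exists k, #|arcs Ts| = k by eexists.
have kgE : #|arcs Tg| = k by rewrite -ksg.
have szAs : size As = k by rewrite (perm_size lAs) -cardE.
have szAg : size Ag = k by rewrite (perm_size lAg) -cardE.
have km : k <= m by rewrite -kE subset_leq_card.
have [pVs szVs] := listed_tree rTs lVs lAs.
have [pVg szVg] := listed_tree rTg lVg lAg.
have kn : k < n.
  have uVs : uniq Vs by rewrite (perm_uniq lVs) enum_uniq.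
  by have := max_card (mem Vs); rewrite (card_uniqP uVs) card_ord szVs kE.
have NW : (n + m + 2) * (n + m + 2) * 2 <= W.
  by rewrite /W !expnS expn0 muln1 mulnA leq_mul // addn2.
apply: wp_cond; rewrite /= szAs mod0n; case: (posnP k) => [k0|k0] /=.
  have Vs1 : Vs = [:: rs].
    by move: pVs; rewrite (size0nil (etrans szAs k0)) => /perm_small_eq->.
  have Vg1 : Vg = [:: rg].
    by move: pVg; rewrite (size0nil (etrans szAg k0)) => /perm_small_eq->.
  have a0 (T : digraph 'I_n) : #|arcs T| = k -> arcs T = set0 by rewrite k0 => /eqP; rewrite cards_eq0 => /eqP.
  have TE : rs = rg -> Ts = Tg.
    move=> E; have vE : vset Ts = vset Tg.
      apply/setP => v; have := perm_mem lVs v; have := perm_mem lVg v.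
      by rewrite !mem_enum Vs1 Vg1 E => ->.
    have := a0 _ kE; have := a0 _ kgE.
    by case: (Ts) (Tg) vE => [? ?] [? ?] /= -> -> ->.
  have EP : reconfigurable G Ts Tg <-> rs = rg.
    split=> [R|/TE E]; last by exists 0, (fun=> Ts); exact: reconf_refl.
    have E := reconf_no_arcs (etrans kE k0) R.
    by apply: rooted_tree_root_unique rTs _; rewrite E.
  wps; rewrite /= !mod0n Vs1 Vg1 /vertex_code /=; split.
  - nlia.
  - by rewrite /accepts /= eqb0 negbK EP; split=> [/eqP/val_inj|->].
  - move=> /EP/TE E; exists 0, (fun=> Ts); split=> //; exact: reconf_refl.
apply: wp_cond; rewrite /= szAs modn_small; last by nlia.
have dsE L (T : digraph 'I_n) : listing L (arcs T) -> forall a, (a \in L) = (a \in arcs T).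
  by move=> lL a; rewrite (perm_mem lL) mem_enum.
rewrite eqb0 negbK; case: eqP => [k1|k1] /=.
  have [a EAs] : exists a, As = [:: a] by case: (As) szAs => [|a [|b q]]; rewrite k1 //; exists a.
  have [b EAg] : exists b, Ag = [:: b] by case: (Ag) szAg => [|b [|c q]]; rewrite k1 //; exists b.
  have aE : arcs Ts = [set a] by apply/setP => c; rewrite -(dsE _ _ lAs) EAs !inE.
  have bE : arcs Tg = [set b] by apply/setP => c; rewrite -(dsE _ _ lAg) EAg !inE.
  have [W1 W0] : 1 < W /\ 0 < W by nlia.
  rewrite EAs EAg; wps; rewrite /tail_code /head_code /= !mod0n (@modn_small 1) //.
  have -> : ((val a.1 == val b.1) * (val a.2 == val b.2)) %% W = (a == b).
    by rewrite mulnb modn_small // (leq_ltn_trans (leq_b1 _)).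
  set s := set_reg _ _ _.
  have r1 : reg s 1 = ((a == b : nat) == 0) by [].
  have [T [Td To]] : exists T, reconf_seq G Ts Tg ((a == b : nat) == 0) T /\
      outputs s ((a == b : nat) == 0) T.
    have [E|/eqP ab] /= := eqVneq a b.
      exists (fun=> Ts); split; last by split=> //; rewrite r1 E eqxx.
      apply: reconf_refl => //; apply: directed_tree_eq; [by case: ds|by case: dg|by rewrite kE|].
      by rewrite aE bE E.
    exists (fun i => if i is 0 then Ts else Tg); split.
      split=> //; first by case.
      move=> [|i] // _; rewrite aE bE.
      have D (x y : 'I_n * 'I_n) : x <> y -> #|[set x] :\: [set y]| = 1.
        move=> xy; apply/eqP/cards1P; exists x; apply/setP => z; rewrite !inE.
        by rewrite andbC; case: eqP => //= ->; apply/eqP.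
      by split; apply: D => // /esym.
    split; first by rewrite r1 (introF eqP ab).
    move=> [|i] // _ u v; rewrite aE bE !inE /=.
    have D (x y : 'I_n * 'I_n) : x <> y -> ((u, v) != y) && ((u, v) == x) =
        (val x.1 == u) && (val x.2 == v).
      move=> xy; rewrite !val_eqE -[RHS]/((x.1, x.2) == (u, v)) -surjective_pairing.
      by rewrite andbC [x == _]eq_sym; case: eqP => //= ->; apply/eqP.
    by split; apply: D => // /esym.
  split.
  - by nlia.
  - by split=> // _; exists ((a == b : nat) == 0), T.
  - move=> _; exists ((a == b : nat) == 0), T; split=> //.
    by rewrite (leq_trans (leq_b1 _)) // muln_gt0 expn_gt0; nlia.
have k2 : 1 < k by rewrite ltn_neqAle k0 andbT; apply/eqP => /esym.
have knn : k.+1 * n <= n * n by rewrite leq_mul2r kn orbT.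
pose code := @code_arc n.
have szA : size (map code A) = m by rewrite size_map.
apply: wp_mono (@wp_solve_large W n (map code A) k (map code As) (map code Ag)
  (map val Vs) (map val Vg) (val rs) (val rg) _ k2 _ _ _ _ _ _ _ _ _ _ _ _ _ _ _ _ _ _ _) _.
- nlia.
- nlia.
- nlia.
- by rewrite szA; nlia.
- nlia.
- by rewrite /= szA -mE szVs kE szAs.
- by move=> i _; rewrite nth_code_arc.
- by move=> i _; rewrite nth_code_arc.
- by move=> i _; rewrite nth_code_arc.
- by [].
- by [].
- by move=> j; rewrite /heads -map_comp.
- by move=> j; rewrite /heads -map_comp.
- by move=> a j a7 /=; rewrite nth_default.
- exact: (listed_input rTs lVs lAs kE).
- exact: (listed_input rTg lVg lAg kgE).
- by move=> _ /mapP[a _ ->]; rewrite /= !ltn_ord.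
- move=> _ /mapP[a + ->]; rewrite (mem_map (@code_arc_inj n)) (dsE _ _ lAs) (dsE _ _ lA).
  by move/subsetP: sTs; apply.
- move=> _ /mapP[a + ->]; rewrite (mem_map (@code_arc_inj n)) (dsE _ _ lAg) (dsE _ _ lA).
  by move/subsetP: sTg; apply.
move=> t s [P [tb PA Pg acc out]].
have seq_of ls lg tr : perm_eq ls (map code As) -> perm_eq lg (map code Ag) ->
    recon (map code A) k ls tr lg -> exists T, reconf_seq G Ts Tg (size tr) T /\
    forall i d, i < size tr -> forall a,
      (a \in arcs (T i) :\: arcs (T i.+1)) = ((nth d tr i).1 == code_arc a) /\
      (a \in arcs (T i.+1) :\: arcs (T i)) = ((nth d tr i).2 == code_arc a).
  move=> ps pg rc; apply: (recon_reconf k0 GV lA ds dg _ _ _ rc).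
  - by rewrite (perm_size ps) size_map.
  - by rewrite /codes_tree (perm_trans ps) // perm_map.
  - by rewrite /codes_tree (perm_trans pg) // perm_map.
have accE : accepts s <-> reconfigurable G Ts Tg.
  split=> [/out[ls [lg [tr [ps pg rc _ _]]]]|[ell [T R]]].
    by have [T [R _]] := seq_of _ _ _ ps pg rc; exists (size tr), T.
  by apply/acc; apply/(reconf_root k2 lA PA kE R rTs rTg).
split=> //.
(* With [m >= 1] and [n >= 2], the terms linear in [m], [n] and [k] are absorbed by [n * m]. *)
- have [m1 n2] : 0 < m /\ 1 < n by split; nlia.
  have knm : k * n <= m * n by rewrite leq_mul2r km orbT.
  have mmn : m * 2 <= m * n by rewrite leq_mul2l n2 orbT.
  have nmn : 1 * n <= m * n by rewrite leq_mul2r m1 orbT.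
  by rewrite szA in tb; nlia.
- move=> /accE/out[ls [lg [tr [ps pg rc sz [r1 rep]]]]].
  have [T [R D]] := seq_of _ _ _ ps pg rc; exists (size tr), T; split=> //.
    have nn : 1 * n <= n * n by rewrite leq_mul2r (leq_trans _ kn) ?orbT.
    by rewrite -mulnn; nlia.
  split=> // i itr u v; have [D1 D2] := D i (arc0, arc0) itr (u, v).
  by rewrite D1 D2 -rep.
Qed.
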